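(* Let $(R,\mathfrak m,\mathsf k)$ be a noetherian local ring with $\operatorname{embdim}(R)\ge 3$. Suppose that either (i) $R$ is a fiber product ring, or (ii) $R$ is an artinian stretched Gorenstein ring and $\operatorname{char}(\mathsf k)\neq 2$. Then for every positive integer $r$ and every finitely generated $R$-module $M$ with $\operatorname{projdim}_R M=\infty$, we have $I^R_{n,r}(M)=\mathfrak m^r$ for all $n\gg 0$.
   Context: For a finitely generated module $M$ over a noetherian local ring $R$, let $(F_\bullet,\partial_\bullet)$ be its minimal free resolution, $\partial_n\colon F_n\to F_{n-1}$. $I^R_{n,r}(M)$ denotes the ideal of $R$ generated by all $r\times r$ minors of a matrix representing $\partial_n$ (independent of bases); by convention it is zero if $r$ exceeds the number of rows or columns, and equals $R$ if $r=0$. $\operatorname{embdim}(R)$ is the minimal number of generators of $\mathfrak m$. Fiber product ring: $R\cong S\times_{\mathsf k}T=\{(s,t)\in S\times T:\bar s=\bar t \text{ in }\mathsf k\}$, where $S$ and $T$ are noetherian local rings with common residue field $\mathsf k$; fiber products are assumed non-trivial, i.e. $S\not\cong\mathsf k$ and $T\not\cong\mathsf k$. An artinian local ring $(R,\mathfrak m)$ is stretched if $\lambda(R)-\operatorname{embdim}(R)$ is the least integer $i$ such that $\mathfrak m^{i+1}=0$, where $\lambda(R)$ is the length of $R$. *)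

(* Defs.v *)
(* Mathematical Components, with subsets ([set R]) and choice from
   mathcomp-classical. *)
From HB Require Import structures.
From mathcomp Require Import all_boot all_order all_algebra.
From mathcomp Require Import boolp classical_sets.
Set Implicit Arguments.
Unset Strict Implicit.
Unset Printing Implicit Defensive.
Import GRing.Theory.
Local Open Scope classical_set_scope.
Local Open Scope ring_scope.

Definition surjective (A B : Type) (f : A -> B) : Prop :=
  forall y, exists x, f x = y.

Section Ideals.
Variable R : comNzRingType.

(* Unlike in mathcomp's [idealr_closed], the unit ideal is an ideal. *)
Record is_ideal (I : set R) : Prop := IsIdeal {
  ideal0 : I 0;
  idealD : forall x y, I x -> I y -> I (x + y);
  idealM : forall a x, I x -> I (a * x) }.

Definition ideal_gen (A : set R) : set R := smallest is_ideal A.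

Definition ideal_mul (I J : set R) : set R :=
  ideal_gen [set z | exists x y, [/\ I x, J y & z = x * y]].

Definition ideal_exp (I : set R) (r : nat) : set R :=
  iter r (ideal_mul I) setT.

Definition is_maximal_ideal (m : set R) : Prop :=
  [/\ is_ideal m, m <> setT &
      forall J, is_ideal J -> m `<=` J -> J = m \/ J = setT].

Definition noetherian : Prop :=
  forall I : set R, is_ideal I -> exists s : seq R, I = ideal_gen [set` s].

Definition artinian : Prop :=
  forall I : nat -> set R, (forall n, is_ideal (I n)) ->
    (forall n, I n.+1 `<=` I n) ->
    exists N, forall n, (N <= n)%N -> I n = I N.

Definition min_number_of_generators (I : set R) (e : nat) : Prop :=
  (exists2 s : seq R, size s = e & I = ideal_gen [set` s]) /\
  (forall s : seq R, I = ideal_gen [set` s] -> (e <= size s)%N).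

(* The length of R as an R-module: R has a composition series
   0 = I_0 < I_1 < ... < I_l = R.  By Jordan-Hoelder there is at most one
   such l. *)
Definition ring_length (l : nat) : Prop :=
  exists I : nat -> set R,
    [/\ I 0%N = [set 0], I l = setT,
        forall i, (i <= l)%N -> is_ideal (I i) &
        forall i, (i < l)%N -> I i `<` I i.+1 /\
          forall J, is_ideal J -> I i `<=` J -> J `<=` I i.+1 ->
            J = I i \/ J = I i.+1].

End Ideals.

(* (R, m, k) is a noetherian local ring.  The residue field R/m is presented
   as a field k together with a surjection R -> k of kernel m. *)
Record noetherian_local (R : comNzRingType) (m : set R) (k : fieldType)
    (pi : {rmorphism R -> k}) : Prop := NoetherianLocal {
  local_noetherian : noetherian R;
  local_maximal : is_maximal_ideal m;
  local_unique : forall J, is_maximal_ideal J -> J = m;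
  residue_surj : surjective pi;
  residue_ker : forall x, pi x = 0 <-> m x }.

(* As the maximal ideal is determined by R, this is a property of R alone
   once (R, m, k) is noetherian local. *)
Definition embdim (R : comNzRingType) (m : set R) (e : nat) : Prop :=
  min_number_of_generators m e.

(* The equation l = e + i is lambda(R) - embdim(R) = i, without truncated
   subtraction. *)
Definition artinian_stretched (R : comNzRingType) (m : set R) : Prop :=
  artinian R /\
  exists l e i : nat,
    [/\ ring_length R l, embdim m e, l = (e + i)%N,
        ideal_exp m i.+1 = [set 0] &
        forall j, ideal_exp m j.+1 = [set 0] -> (i <= j)%N].

Section FiberProduct.
Variables (S T : comNzRingType) (k : fieldType).
Variables (p : {rmorphism S -> k}) (q : {rmorphism T -> k}).

Definition fiber_pred : pred (S * T) := fun x => p x.1 == q x.2.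

Fact fiber_subring_closed : subring_closed fiber_pred.
Proof.
split; rewrite /fiber_pred /in_mem /=.
- by rewrite !rmorph1.
- by move=> x y /eqP Hx /eqP Hy; rewrite /in_mem /= !rmorphB Hx Hy.
- by move=> x y /eqP Hx /eqP Hy; rewrite /in_mem /= !rmorphM Hx Hy.
Qed.

HB.instance Definition _ :=
  GRing.isSubringClosed.Build (S * T)%type fiber_pred fiber_subring_closed.

Record fiber_product := FiberProduct {
  fiber_val :> S * T; fiber_valP : fiber_val \in fiber_pred }.

HB.instance Definition _ := [isSub for fiber_val].
HB.instance Definition _ := [Choice of fiber_product by <:].
HB.instance Definition _ := [SubChoice_isSubComNzRing of fiber_product by <:].

End FiberProduct.

Definition ring_isomorphic (A B : comNzRingType) : Prop :=
  exists f : {rmorphism A -> B}, bijective f.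

Definition is_fiber_product_ring (R : comNzRingType) (k : fieldType) : Prop :=
  exists (S T : comNzRingType) (mS : set S) (mT : set T)
    (p : {rmorphism S -> k}) (q : {rmorphism T -> k}),
    [/\ noetherian_local mS p, noetherian_local mT q,
        ~ ring_isomorphic S k, ~ ring_isomorphic T k &
        ring_isomorphic R (fiber_product p q)].

Section Modules.
Variable R : comNzRingType.

Definition finitely_generated (M : lmodType R) : Prop :=
  exists (n : nat) (g : 'I_n -> M),
    forall x, exists c : 'I_n -> R, x = \sum_(i < n) c i *: g i.

Definition zero_module (M : lmodType R) : Prop := forall x : M, x = 0.

Definition exact_at (A B C : lmodType R) (f : A -> B) (g : B -> C) : Prop :=
  forall y : B, g y = 0 <-> exists x : A, y = f x.

Definition projective (P : lmodType R) : Prop :=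
  forall (A B : lmodType R) (g : {linear A -> B}) (f : {linear P -> B}),
    surjective g -> exists h : {linear P -> A}, forall x, g (h x) = f x.

Definition injective_module (E : lmodType R) : Prop :=
  forall (A B : lmodType R) (i : {linear A -> B}) (f : {linear A -> E}),
    injective i -> exists h : {linear B -> E}, forall x, h (i x) = f x.

Definition projdim_le (M : lmodType R) (n : nat) : Prop :=
  exists (P : nat -> lmodType R) (d : forall i, {linear P i.+1 -> P i})
    (eps : {linear P 0%N -> M}),
    [/\ forall i, projective (P i),
        forall i, (n < i)%N -> zero_module (P i),
        surjective eps,
        exact_at (d 0%N) eps &
        forall i, exact_at (d i.+1) (d i)].

Definition projdim_infinite (M : lmodType R) : Prop :=
  forall n, ~ projdim_le M n.

Definition injdim_le (M : lmodType R) (n : nat) : Prop :=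
  exists (E : nat -> lmodType R) (d : forall i, {linear E i -> E i.+1})
    (eta : {linear M -> E 0%N}),
    [/\ forall i, injective_module (E i),
        forall i, (n < i)%N -> zero_module (E i),
        injective eta,
        exact_at eta (d 0%N) &
        forall i, exact_at (d i) (d i.+1)].

(* Free modules are based: F_n = R^(rk n), as row vectors, and the
   differential F_{n+1} -> F_n is right multiplication by dmx n. *)
Record free_resolution (M : lmodType R) := FreeResolution {
  rk : nat -> nat;
  dmx : forall n, 'M[R]_(rk n.+1, rk n);
  aug : {linear 'rV[R]_(rk 0) -> M};
  aug_surj : surjective aug;
  aug_exact : exact_at (fun w : 'rV[R]_(rk 1) => w *m dmx 0) aug;
  dmx_exact : forall n,
    exact_at (fun w : 'rV[R]_(rk n.+2) => w *m dmx n.+1)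
             (fun v : 'rV[R]_(rk n.+1) => v *m dmx n) }.

Definition is_minimal (m : set R) (M : lmodType R) (F : free_resolution M) :=
  forall n i j, m (dmx F n i j).

(* For r = 0 the only minor is the empty determinant 1; if r exceeds p or q
   there are no minors at all and the ideal is zero. *)
Definition minors_ideal (p q : nat) (r : nat) (A : 'M[R]_(p, q)) : set R :=
  ideal_gen [set x | exists (f : 'I_r -> 'I_p) (g : 'I_r -> 'I_q),
    [/\ {homo f : i j / (i < j)%N}, {homo g : i j / (i < j)%N} &
        x = \det (mxsub f g A)]].

(* I_{n,r}: the r x r minors of the differential F_n -> F_{n-1}, where
   F_{-1} = 0. *)
Definition resolution_minors (M : lmodType R) (F : free_resolution M)
    (n r : nat) : set R :=
  match n with
  | 0 => minors_ideal r (0 : 'M[R]_(rk F 0, 0))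
  | n'.+1 => minors_ideal r (dmx F n')
  end.

End Modules.

Definition gorenstein (R : comNzRingType) : Prop :=
  exists n, injdim_le (R^o : lmodType R) n.

(* Main.v *)
Require Import Defs.
From HB Require Import structures.
From mathcomp Require Import all_boot all_order all_algebra.
From mathcomp Require Import fingroup perm.
From mathcomp Require Import boolp classical_sets.
From mathcomp Require Import ring zify.
Set Implicit Arguments.
Unset Strict Implicit.
Unset Printing Implicit Defensive.
Import GRing.Theory.
Local Open Scope classical_set_scope.
Local Open Scope ring_scope.

(* Write F_n = R^(b_n).  In both cases the ranks grow and the differentials are
   controlled by their coordinates modulo hyperplanes J of m, which become
   matrices over k.

   (i) If R is a fiber product, then m = a + b with ab = 0 and a, b meeting in 0.
   Every syzygy inside m F_n is then the direct sum of a part in a F_n and a part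
   in b F_n; a projection Y onto the first part satisfies t Y F_n <= im d for t
   in b, and (1 - Y) likewise for a.  With r <= rank Y and r <= rank (1 - Y) the
   r-minors contain all r-fold products from a and from b, hence m^r.  As a and b
   have at least 3 generators together, both ranks tend to infinity.

   (ii) If R is stretched, then m^2 = (yw) is a uniserial ideal.  A matrix with
   entries in m^2 with more rows than columns has a left kernel of the expected
   size, so elements of m F_n can be corrected to syzygies.  This gives
   b_(n+2) >= 3 b_(n+1) - b_n and, for a hyperplane J, that d_n mod J has rank at
   least b_n - b_(n-1), which is unbounded.  If m^3 <> 0 then m^2 = (x^2), and for
   J = Ann_m(x) a minor of d_n is x^r times a minor of d_n mod J, up to m^(r+1).
   If m^3 = 0, only r <= 2 matters, and the vanishing of all 2-minors would bound
   the rank of d_n mod J for J = Ann_m(d), d an entry of d_n. *)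

(** * Ideals and minors *)

Section IdealTheory.
Variable R : comNzRingType.
Implicit Types (I J m : set R) (x y z : R).

Lemma idealN I x : is_ideal I -> I x -> I (- x).
Proof. by move=> hI Ix; rewrite -mulN1r; apply: idealM. Qed.

Lemma idealB I x y : is_ideal I -> I x -> I y -> I (x - y).
Proof. by move=> hI Ix Iy; apply: idealD => //; apply: idealN. Qed.

Lemma ideal_mulr I a x : is_ideal I -> I x -> I (x * a).
Proof. by move=> hI Ix; rewrite mulrC; apply: idealM. Qed.

Lemma ideal_sum I (T : finType) (P : pred T) (F : T -> R) :
  is_ideal I -> (forall i, P i -> I (F i)) -> I (\sum_(i | P i) F i).
Proof.
by move=> hI IF; elim/big_ind: _ => //; [apply: ideal0|move=> x y; apply: idealD].
Qed.

Lemma is_ideal0 : is_ideal [set 0 : R].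
Proof.
by split=> [|_ _ -> ->|a _ ->] //; rewrite /= ?addr0 ?mulr0.
Qed.

Lemma is_idealT : is_ideal [set: R].
Proof. by split. Qed.

Lemma ideal_gen_ideal (A : set R) : is_ideal (ideal_gen A).
Proof.
split=> [I [hI _]|x y Ax Ay I hI|a x Ax I hI]; first exact: ideal0.
  by apply: idealD; [case: hI|apply: Ax|apply: Ay].
by apply: idealM; [case: hI|apply: Ax].
Qed.

Lemma sub_ideal_gen (A : set R) : A `<=` ideal_gen A.
Proof. by move=> x Ax I [_]; apply. Qed.

Lemma ideal_gen_sub (A : set R) I : is_ideal I -> A `<=` I -> ideal_gen A `<=` I.
Proof. by move=> hI AI x; apply. Qed.

Definition lincomb_set n (x : 'I_n -> R) : set R :=
  [set y | exists c : 'I_n -> R, y = \sum_i c i * x i].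

Lemma lincomb_set_ideal n (x : 'I_n -> R) : is_ideal (lincomb_set x).
Proof.
split=> [|_ _ [c ->] [d ->]|a _ [c ->]].
- by exists (fun=> 0); rewrite big1 // => i _; rewrite mul0r.
- by exists (fun i => c i + d i); rewrite -big_split; apply: eq_bigr => i _; rewrite mulrDl.
- by exists (fun i => a * c i); rewrite mulr_sumr; apply: eq_bigr => i _; rewrite mulrA.
Qed.

Lemma mem_lincomb_set n (x : 'I_n -> R) i : lincomb_set x (x i).
Proof.
exists (fun j => (j == i)%:R); rewrite (bigD1 i) //= eqxx mul1r big1 ?addr0 //.
by move=> j /negPf ->; rewrite mul0r.
Qed.

Lemma lincomb_set_sub n (x : 'I_n -> R) I :
  is_ideal I -> (forall i, I (x i)) -> lincomb_set x `<=` I.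
Proof. by move=> hI Ix _ [c ->]; apply: ideal_sum => // i _; apply: idealM. Qed.

Lemma ideal_gen_seqE (s : seq R) :
  ideal_gen [set` s] = lincomb_set (fun i : 'I_(size s) => s`_i).
Proof.
apply/seteqP; split; last first.
  apply: lincomb_set_sub; first exact: ideal_gen_ideal.
  by move=> i; apply: sub_ideal_gen => /=; apply: mem_nth.
apply: ideal_gen_sub => [|x /= xs]; first exact: lincomb_set_ideal.
have ix : (index x s < size s)%N by rewrite index_mem.
by have := mem_lincomb_set (fun i : 'I_(size s) => s`_i) (Ordinal ix); rewrite /= nth_index.
Qed.

Lemma lincomb_setE n (x : 'I_n -> R) : lincomb_set x = ideal_gen [set` codom x].
Proof.
apply/seteqP; split.
  apply: lincomb_set_sub; first exact: ideal_gen_ideal.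
  by move=> i; apply: sub_ideal_gen => /=; apply: codom_f.
apply: ideal_gen_sub => [|y /= /codomP[i ->]]; first exact: lincomb_set_ideal.
exact: mem_lincomb_set.
Qed.

Lemma ideal_mul_ideal I J : is_ideal (ideal_mul I J).
Proof. exact: ideal_gen_ideal. Qed.

Lemma ideal_exp_ideal m r : is_ideal (ideal_exp m r).
Proof. by case: r => [|r] /=; [apply: is_idealT|apply: ideal_mul_ideal]. Qed.

Lemma ideal_expMS m r x y : m x -> ideal_exp m r y -> ideal_exp m r.+1 (x * y).
Proof. by move=> mx my; apply: sub_ideal_gen; exists x, y. Qed.

Lemma prod_ideal_exp m r (u : 'I_r -> R) :
  (forall i, m (u i)) -> ideal_exp m r (\prod_i u i).
Proof.
elim: r u => [//|r IH] u mu; rewrite big_ord_recl.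
by apply: ideal_expMS => //; apply: IH.
Qed.

Lemma ideal_expS_sub m r I : is_ideal I ->
  (forall x y, m x -> ideal_exp m r y -> I (x * y)) -> ideal_exp m r.+1 `<=` I.
Proof. by move=> hI mI; apply: ideal_gen_sub => // _ [x [y [mx my ->]]]; apply: mI. Qed.

Lemma ideal_exp_sub m r I : is_ideal I ->
  (forall u : 'I_r -> R, (forall i, m (u i)) -> I (\prod_i u i)) ->
  ideal_exp m r `<=` I.
Proof.
elim: r I => [|r IH] I hI mI.
  have I1 : I 1 by have := mI (fun=> 0); rewrite big_ord0; apply; case.
  by move=> x _; rewrite -[x]mulr1; apply: idealM.
apply: ideal_expS_sub => // x y mx.
apply: (IH [set y | I (x * y)]) => [|u mu].
  by split=> [|a b|a b] /=; rewrite ?mulr0 ?mulrDr 1?mulrCA;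
     [apply: ideal0|apply: idealD|apply: idealM].
have := mI (fun i => oapp u x (unlift ord0 i)); rewrite big_ord_recl /= unlift_none /=.
under eq_bigr do rewrite liftK /=.
by apply=> i; case: (unlift ord0 i).
Qed.

Lemma ideal_exp_decS m r : ideal_exp m r.+1 `<=` ideal_exp m r.
Proof.
have hI := ideal_exp_ideal m r.
by apply: ideal_expS_sub => // x y mx my; apply: idealM.
Qed.

Lemma ideal_exp_dec m r s : (r <= s)%N -> ideal_exp m s `<=` ideal_exp m r.
Proof.
move/subnKC <-; elim: (s - r)%N => [|j IH]; first by rewrite addn0.
by rewrite addnS => x /ideal_exp_decS /IH.
Qed.

Lemma ideal_exp1 m : is_ideal m -> ideal_exp m 1 = m.
Proof.
move=> hm; apply/seteqP; split.
  by apply: ideal_expS_sub => // x y mx _; apply: ideal_mulr.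
by move=> x mx; rewrite -[x]mulr1; apply: ideal_expMS.
Qed.

Lemma ideal_exp2M m x y : is_ideal m -> m x -> m y -> ideal_exp m 2 (x * y).
Proof. by move=> hm mx my; apply: ideal_expMS => //; rewrite ideal_exp1. Qed.

End IdealTheory.

Section Minors.
Variable R : comNzRingType.

(** Multilinearity in the rows: the products in the Leibniz formula are distributed over the sums.
    The maps [h] need not be injective. *)
Lemma det_row_lincomb r p (Z : 'M[R]_(r, p)) (M : 'M[R]_(p, r)) :
  \det (Z *m M) =
  \sum_(h : {ffun 'I_r -> 'I_p}) (\prod_i Z i (h i)) * \det (rowsub h M).
Proof.
pose F s (i : 'I_r) (j : 'I_p) := Z i j * M j ((s : 'S_r) i).
transitivity (\sum_(s : 'S_r) \sum_(h : {ffun 'I_r -> 'I_p}) (-1) ^+ s * \prod_i F s i (h i)).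
  apply: eq_bigr => s _; rewrite -big_distrr /= -(bigA_distr_bigA (F s)) /=.
  by congr (_ * _); apply: eq_bigr => i _; rewrite mxE.
rewrite exchange_big; apply: eq_bigr => h _ /=; rewrite big_distrr /=.
apply: eq_bigr => s _; rewrite big_split /= mulrCA; congr (_ * (_ * _)).
by apply: eq_bigr => i _; rewrite mxE.
Qed.

Lemma injective_sort r p (f : 'I_r -> 'I_p) : injective f ->
  exists s : 'S_r, {homo (fun i => f (s i)) : i j / (i < j)%N}.
Proof.
move=> injf; pose t := [tuple f i | i < r].
have /tuple_permP[s ts] : perm_eq (sort_tuple (fun i j : 'I_p => i <= j)%N t) t.
  by rewrite perm_sort.
exists s => i j ij /=.
have tt : total (fun i j : 'I_p => i <= j)%N by move=> a b; apply: leq_total.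
have tr : transitive (fun i j : 'I_p => i <= j)%N by move=> a b c; apply: leq_trans.
have so : sorted (fun i j : 'I_p => i <= j)%N (sort_tuple (fun i j : 'I_p => i <= j)%N t).
  exact: sort_sorted.
have nt a : nth (f a) (sort_tuple (fun i j : 'I_p => i <= j)%N t) a = f (s a).
  by rewrite ts -tnth_nth !tnth_mktuple.
have := sorted_leq_nth tr (fun x => leqnn x) (f i) so i j.
rewrite !inE !size_tuple !ltn_ord => /(_ isT isT (ltnW ij)).
rewrite nt (set_nth_default (f j)) ?size_tuple // nt leq_eqVlt => /orP[/eqP/val_inj|//].
by move/injf/perm_inj => e; rewrite e ltnn in ij.
Qed.

Lemma minors_ideal_ideal p q r (D : 'M[R]_(p, q)) : is_ideal (minors_ideal r D).
Proof. exact: ideal_gen_ideal. Qed.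

(** A repeated row or column gives determinant zero; otherwise sorting the indices changes the minor
    only by the signs of two permutations. *)
Lemma minors_ideal_mem p q r (D : 'M[R]_(p, q)) (f : 'I_r -> 'I_p) (g : 'I_r -> 'I_q) :
  minors_ideal r D (\det (mxsub f g D)).
Proof.
have hI := minors_ideal_ideal r D.
have [/injectiveP injf|/injectivePn[i1 [i2 ne eqf]]] := boolP (injectiveb f); last first.
  rewrite (determinant_alternate ne); first exact: ideal0.
  by move=> j; rewrite !mxE eqf.
have [/injectiveP injg|/injectivePn[i1 [i2 ne eqg]]] := boolP (injectiveb g); last first.
  rewrite -det_tr (determinant_alternate ne); first exact: ideal0.
  by move=> j; rewrite !mxE eqg.
have [s fs] := injective_sort injf; have [t gt] := injective_sort injg.
have e : mxsub (f \o s) (g \o t) D = perm_mx s *m mxsub f g D *m perm_mx t^-1.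
  rewrite -row_permE -col_permE.
  by apply/matrixP => i j; rewrite !mxE.
have : minors_ideal r D (\det (mxsub (f \o s) (g \o t) D)).
  by apply: sub_ideal_gen; exists (f \o s), (g \o t).
rewrite e !det_mulmx !det_perm => /(idealM hI ((-1) ^+ s * (-1) ^+ t^-1%g)).
congr (minors_ideal r D _).
set a := (-1) ^+ s; set b := (-1) ^+ _.
have -> : a * b * (a * \det (mxsub f g D) * b) = (a * a) * (b * b) * \det (mxsub f g D) by ring.
by rewrite /a /b -!expr2 !sqrr_sign !mul1r.
Qed.

Lemma minors_ideal_lincomb p q r (D : 'M[R]_(p, q)) (Z : 'M[R]_(r, p)) (g : 'I_r -> 'I_q) :
  minors_ideal r D (\det (Z *m colsub g D)).
Proof.
have hI := minors_ideal_ideal r D.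
rewrite det_row_lincomb; apply: ideal_sum => // h _; apply: (idealM hI).
by rewrite -mxsub_comp; apply: minors_ideal_mem.
Qed.

Lemma minors_ideal_sub (m : set R) p q r (D : 'M[R]_(p, q)) :
  (forall i j, m (D i j)) -> minors_ideal r D `<=` ideal_exp m r.
Proof.
move=> mD; have hI := ideal_exp_ideal m r.
apply: ideal_gen_sub => // _ [f [g [_ _ ->]]].
apply: ideal_sum => // s _; apply: idealM => //.
by apply: prod_ideal_exp => i; rewrite mxE.
Qed.

End Minors.

Lemma rank_unit_minor (k : fieldType) p q r (A : 'M[k]_(p, q)) : (r <= \rank A)%N ->
  exists (f : 'I_r -> 'I_p) (g : 'I_r -> 'I_q), \det (mxsub f g A) != 0.
Proof.
move=> rA; pose f := maxrankfun A \o widen_ord rA.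
have fr : row_free (rowsub f A).
  have /row_freeP[B AB] := maxrowsub_free A; apply/row_freeP.
  pose w := widen_ord rA; exists (B *m (rowsub w 1%:M)^T).
  rewrite (_ : rowsub f A = rowsub w 1%:M *m rowsub (maxrankfun A) A); last first.
    by rewrite mul_rowsub_mx mul1mx /f -mxsub_comp.
  rewrite -mulmxA (mulmxA _ B) AB mul1mx trmx_mxsub trmx1.
  rewrite mul_rowsub_mx mul1mx; apply/matrixP => i j; rewrite !mxE.
  by congr (_ %:R); apply/eqP/eqP => [/(congr1 val)/= /val_inj|->].
have fT : row_full (rowsub f A)^T by rewrite /row_full mxrank_tr; exact: fr.
move: (fullrankfun fT) (fullrowsub_unit fT) => g gU; exists f, g; move: gU.
rewrite unitmxE unitfE -det_tr.
by congr (\det _ != 0); apply/matrixP => i j; rewrite !mxE.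
Qed.

(** * Linear algebra over a local ring *)

Lemma maximal_ideal_above (R : comNzRingType) (I : set R) :
  is_ideal I -> ~ I 1 -> exists2 J, is_maximal_ideal J & I `<=` J.
Proof.
move=> hI I1.
(* [set0] is allowed because Zorn_bigcup applies to the empty chain too. *)
pose P A := A = set0 \/ [/\ is_ideal A, ~ A 1 & I `<=` A].
have [F FP Ftot|E [PE Emax]] := @Zorn_bigcup R P.
  have [Fne|Fe] := pselect (exists2 A, F A & A <> set0); last first.
    left; apply/seteqP; split=> // x [A FA Ax]; apply: Fe; exists A => // A0.
    by rewrite A0 in Ax.
  case: Fne => A FA A0; case: (FP _ FA) => // -[hA A1 IA].
  have FI B : F B -> B <> set0 -> is_ideal B /\ ~ B 1.
    by move=> FB B0; case: (FP _ FB) => // -[].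
  have ne (B : set R) x : B x -> B <> set0 by move=> + B0; rewrite B0.
  right; split; last by move=> x /IA Ax; exists A.
    split=> [|x y [B FB Bx] [C FC Cy]|a x [B FB Bx]].
    - by exists A => //; apply: ideal0.
    - have [hB _] := FI _ FB (ne _ _ Bx); have [hC _] := FI _ FC (ne _ _ Cy).
      case: (Ftot _ _ FB FC) => s; [exists C|exists B] => //; apply: idealD => //.
        exact: s.
      exact: s.
    - by exists B => //; apply: idealM => //; case: (FI _ FB (ne _ _ Bx)).
  by move=> [B FB B1]; case: (FI _ FB (ne _ _ B1)).
case: PE => [E0|[hE E1 IE]].
  exfalso; apply: (Emax I); last by right; split.
  by split; [rewrite E0|rewrite E0 => /(_ 0); apply; apply: ideal0].
exists E => //; split=> //; first by move=> ET; apply: E1; rewrite ET.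
move=> J hJ EJ; have [J1|J1] := pselect (J 1).
  by right; apply/seteqP; split=> // x _; rewrite -[x]mulr1; apply: idealM.
left; apply/seteqP; split=> //; apply: contrapT => JE.
by apply: (Emax J); [split|right; split=> // x /IE /EJ].
Qed.

Lemma local_unit (R : comNzRingType) (m : set R) (k : fieldType)
    (pi : {rmorphism R -> k}) a :
  noetherian_local m pi -> pi a <> 0 -> exists b, a * b = 1.
Proof.
move=> hR pa; apply: contrapT => na.
pose I : set R := [set y | exists b, y = a * b].
have hI : is_ideal I.
  split=> [|_ _ [b ->] [c ->]|c _ [b ->]]; first by exists 0; rewrite mulr0.
    by exists (b + c); rewrite mulrDr.
  by exists (c * b); rewrite mulrCA.
have [|J hJ IJ] := maximal_ideal_above hI; first by case=> b e; apply: na; exists b.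
apply: pa; apply/(residue_ker hR); rewrite -(local_unique hR hJ).
by apply: IJ; exists 1; rewrite mulr1.
Qed.

Section Local.
Variables (R : comNzRingType) (k : fieldType) (pi : {rmorphism R -> k}).
Hypothesis unitR : forall a, pi a <> 0 -> exists b, a * b = 1.
Local Notation m := [set x | pi x = 0].
Implicit Types (I J : set R) (x y : R).

Lemma max_ideal : is_ideal m.
Proof.
by split=> [|x y|a x] /=; rewrite ?rmorph0 ?rmorphD ?rmorphM //;
  [move=> -> ->; rewrite addr0|move=> ->; rewrite mulr0].
Qed.

(** If [J] contains m^2 and [x] lies in m, then [J] is a hyperplane of m/m^2 and [x] spans a
    complement. The weaker form leaves room for annihilators, which need not contain m^2. *)
Definition hyperplane J x :=
  [/\ is_ideal J, ~ J x & forall y, pi y = 0 -> exists a, J (y - a * x)].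

Lemma hyperplane_scal J x a : hyperplane J x -> J (x * a) -> pi a = 0.
Proof.
move=> [hJ Jx _] Jxa; apply: contrapT => /unitR[b ab]; apply: Jx.
by rewrite -[x]mulr1 -ab mulrA; apply: ideal_mulr.
Qed.

Definition generates_over I n (x : 'I_n -> R) :=
  forall y, pi y = 0 -> exists c : 'I_n -> R, I (y - \sum_i c i * x i).

(** Take [n] minimal among families in [G] generating m modulo [I], and let [J i] consist of the
    elements with an expansion modulo [I] whose i-th coefficient is in m. Were [x i] in [J i], it
    could be solved for and dropped. [G] records where the generators lie. *)
Lemma dual_hyperplanes I (G : R -> Prop) n0 (x0 : 'I_n0 -> R) :
  is_ideal I -> (forall i, G (x0 i)) -> generates_over I x0 ->
  exists n (x : 'I_n -> R) (J : 'I_n -> set R),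
    [/\ forall i, G (x i), generates_over I x,
        forall i, hyperplane (J i) (x i),
        forall i, I `<=` J i &
        forall i j, i != j -> J i (x j)].
Proof.
move=> hI Gx0 gen0.
pose P n := `[< exists x : 'I_n -> R, (forall i, G (x i)) /\ generates_over I x >].
have exP : exists n, P n by exists n0; apply/asboolP; exists x0.
have [n /asboolP[x [Gx genx]] minn] := ex_minnP exP.
pose J (i : 'I_n) : set R :=
  [set y | exists2 c : 'I_n -> R, I (y - \sum_j c j * x j) & pi (c i) = 0].
exists n, x, J; split=> // [i|i y Iy|i j ij]; last 2 first.
- exists (fun=> 0); last by rewrite rmorph0.
  by rewrite big1 ?subr0 // => j _; rewrite mul0r.
- exists (fun l => (l == j)%:R); last by rewrite (negPf ij) rmorph0.
  rewrite (bigD1 j) //= eqxx mul1r big1 ?addr0 ?subrr; first exact: ideal0.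
  by move=> l /negPf ->; rewrite mul0r.
split.
- split=> [|y z [c Iy ci] [d Iz di]|a y [c Iy ci]].
  + exists (fun=> 0); last by rewrite rmorph0.
    by rewrite big1 ?subr0 => [|j _]; [apply: ideal0|rewrite mul0r].
  + exists (fun j => c j + d j); last by rewrite rmorphD /= ci di addr0.
    under eq_bigr do rewrite mulrDl.
    by rewrite big_split /= opprD addrACA; apply: idealD.
  + exists (fun j => a * c j); last by rewrite rmorphM /= ci mulr0.
    under eq_bigr do rewrite -mulrA.
    by rewrite -mulr_sumr -mulrBr; apply: idealM.
- case=> c Ix ci.
  have [u cu] : exists u, (1 - c i) * u = 1.
    by apply: unitR; rewrite rmorphB rmorph1 /= ci subr0; apply/eqP/oner_neq0.
  have [n' nE] : exists n', n = n'.+1 by exists n.-1; rewrite prednK // (leq_ltn_trans _ (ltn_ord i)).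
  subst n.
  have : (n'.+1 <= n')%N; last by rewrite ltnn.
  apply: minn; apply/asboolP; exists (x \o lift i); split=> [j|y /genx[d Iy]].
    exact: Gx.
  exists (fun j => d (lift i j) + d i * u * c (lift i j)).
  move: Ix => /(idealM hI (d i * u)) /(idealD hI Iy); congr (I _).
  rewrite !(bigD1_ord i) //=.
  under [in RHS]eq_bigr do rewrite mulrDl -(mulrA (d i * u)).
  rewrite big_split /= -mulr_sumr; set s1 := \sum_ _ _; set s2 := \sum_ _ _.
  have -> : d i * u * (x i - (c i * x i + s2)) =
    d i * x i * ((1 - c i) * u) - d i * u * s2 by ring.
  by rewrite cu; ring.
- move=> y /genx[c Iy]; exists (c i); exists (fun j => if j == i then 0 else c j).
    move: Iy; congr (I _); rewrite (bigD1 i) //= [in RHS](bigD1 i) //= eqxx mul0r add0r.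
    rewrite opprD addrA; congr (_ - _).
    by apply: eq_bigr => j /negPf ->.
  by rewrite eqxx rmorph0.
Qed.

Lemma hyperplane_coord J x p q (D : 'M[R]_(p, q)) :
  hyperplane J x -> (forall i j, pi (D i j) = 0) ->
  exists A : 'M[R]_(p, q), forall i j, J ((D - x *: A) i j).
Proof.
move=> [hJ _ hypE] mD.
have [A AE] := choice (fun ij : 'I_p * 'I_q => hypE _ (mD ij.1 ij.2)).
exists (\matrix_(i, j) A (i, j)) => i j.
by rewrite !mxE mulrC; apply: (AE (i, j)).
Qed.

(** Coordinates along [x] are unique modulo m by [hyperplane_scal], so taking them commutes with
    left multiplication by [Y]. *)
Lemma hyperplane_coordM J x p q (D A : 'M[R]_(p, q)) s (Y : 'M_(s, p)) U :
  hyperplane J x -> (forall i j, J ((D - x *: A) i j)) ->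
  (forall i j, J ((Y *m D - x *: U) i j)) ->
  map_mx pi Y *m map_mx pi A = map_mx pi U.
Proof.
move=> hyp AJ YJ; have [hJ _ hypE] := hyp.
rewrite -map_mxM; apply/matrixP => i j; rewrite [LHS]mxE [RHS]mxE.
apply/eqP; rewrite -subr_eq0 -rmorphB; apply/eqP/(hyperplane_scal hyp).
have YAJ : J ((Y *m (D - x *: A)) i j).
  by rewrite mxE; apply: ideal_sum => // l _; apply: idealM.
have := idealB hJ (YJ i j) YAJ; congr (J _).
by rewrite mulmxBr -scalemxAr !mxE; ring.
Qed.

(** * Gaussian elimination when divisibility is total *)

Section Pivoting.
Variable K : set R.
Hypotheses (hK : is_ideal K)
  (Ktotal : forall u v, K u -> K v -> (exists c, v = c * u) \/ (exists c, u = c * v)).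

Lemma common_divisor n (f : 'I_n.+1 -> R) :
  (forall i, K (f i)) -> exists p, forall i, exists c, f i = c * f p.
Proof.
elim: n f => [|n IH] f Kf.
  by exists ord0 => i; exists 1; rewrite mul1r ord1.
have [p fp] := IH (f \o lift ord0) (fun i => Kf _).
case: (Ktotal (Kf (lift ord0 p)) (Kf ord0)) => -[c cE].
  exists (lift ord0 p) => i; case: (unliftP ord0 i) => [j|] ->; first exact: fp.
  by exists c.
exists ord0 => i; case: (unliftP ord0 i) => [j|] ->; last by exists 1; rewrite mul1r.
by have [d /= ->] := fp j; exists (d * c); rewrite -mulrA -cE.
Qed.

(** A pivot dividing its whole column clears that column at the cost of one row, so [b] columns cost
    at most [b] rows. Freeness over [k] means that the relations found are independent modulo m. *)
Lemma free_left_kernel b c s (W : 'M[R]_(c, b)) :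
  (forall i j, K (W i j)) -> (s + b <= c)%N ->
  exists2 U : 'M[R]_(s, c), U *m W = 0 & row_free (map_mx pi U).
Proof.
elim: b c W => [|b IH] c W KW sbc.
  exists (pid_mx s); first exact: thinmx0.
  by rewrite map_pid_mx /row_free rank_pid_mx // -[s]addn0.
case: c W KW sbc => [|c] W KW; rewrite addnS ?ltnS // => sbc.
have [p /choice[t tE]] := common_divisor (fun i => KW i ord0).
(* Row [i] of [T] subtracts from row [lift p i] the multiple of the pivot row [p] that cancels its
   first entry; row [p] itself is dropped. *)
pose T := \matrix_(i < c, j < c.+1) ((j == lift p i)%:R - t (lift p i) *+ (j == p)).
have TW i j : (T *m W) i j = W (lift p i) j - t (lift p i) * W p j.
  rewrite mxE (bigD1_ord p) //= !mxE eqxx (negPf (neq_lift _ _)) sub0r mulNr addrC.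
  congr (_ - _); rewrite (bigD1 i) //= mxE eqxx eq_sym (negPf (neq_lift _ _)) subr0 mul1r.
  rewrite big1 ?addr0 // => l li.
  by rewrite mxE (inj_eq lift_inj) (negPf li) eq_sym (negPf (neq_lift _ _)) subr0 mul0r.
have [|U' UW Ufree] := IH c (col' ord0 (T *m W)) _ sbc.
  by move=> i j; rewrite mxE TW; apply: idealB => //; apply: idealM.
exists (U' *m T).
  apply/matrixP => i j; rewrite -mulmxA [RHS]mxE.
  case: (unliftP ord0 j) => [j'|] ->.
    move/matrixP: UW => /(_ i j'); rewrite mxE [RHS]mxE => UW0.
    by rewrite mxE -[RHS]UW0; apply: eq_bigr => l _; congr (_ * _); rewrite [RHS]mxE.
  by rewrite mxE big1 // => l _; rewrite TW tE subrr mulr0.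
have Tfree : row_free (map_mx pi T).
  apply/row_freeP; exists (\matrix_(j, i) (j == lift p i)%:R).
  apply/matrixP => i j; rewrite !mxE (bigD1 (lift p j)) //= !mxE eqxx mulr1.
  rewrite (inj_eq lift_inj) [lift p j == p]eq_sym (negPf (neq_lift _ _)) subr0 rmorph_nat.
  rewrite big1 ?addr0 1?eq_sym // => l /negPf lj.
  by rewrite [X in _ * X]mxE lj mulr0.
by rewrite map_mxM /row_free mxrankMfree.
Qed.

End Pivoting.

(* Only the inclusion ker D' <= im D; the other half is [resolution_complex]. *)
Definition exact_mx a b c (D : 'M[R]_(a, b)) (D' : 'M[R]_(b, c)) :=
  forall s (V : 'M_(s, b)), V *m D' = 0 -> exists Z, V = Z *m D.

End Local.

(** * Rings whose squared maximal ideal is principal *)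

(** Every mixed product contains some [u i * v j]. At least one factor is needed, since two empty
    products would sum to 2. *)
Lemma prod_orthogonalD (R : comNzRingType) r (u v : 'I_r.+1 -> R) :
  (forall i j, u i * v j = 0) ->
  \prod_i (u i + v i) = \prod_i u i + \prod_i v i.
Proof.
elim: r u v => [|r IH] u v uv; first by rewrite !big_ord1.
rewrite big_ord_recl IH => [|i j]; last exact: uv.
rewrite !(big_ord_recl r.+1) mulrDl !mulrDr.
rewrite (_ : u ord0 * \prod_(i < r.+1) v (lift ord0 i) = 0) ?addr0; last by rewrite big_ord_recl mulrA uv mul0r.
by rewrite (_ : v ord0 * \prod_(i < r.+1) u (lift ord0 i) = 0) ?add0r // big_ord_recl mulrA [_ * u _]mulrC uv mul0r.
Qed.

Lemma det_orthogonalD (R : comNzRingType) r (A E : 'M[R]_r.+1) x :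
  (forall i j, x * E i j = 0) -> \det (x *: A + E) = x ^+ r.+1 * \det A + \det E.
Proof.
move=> xE; rewrite -detZ -big_split /=; apply: eq_bigr => s _.
rewrite -mulrDr -prod_orthogonalD => [|i j]; first by congr (_ * _); apply: eq_bigr => i _; rewrite mxE.
by rewrite mxE mulrAC xE mul0r.
Qed.

Section Stretched.
Variables (R : comNzRingType) (k : fieldType) (pi : {rmorphism R -> k}).
Hypothesis unitR : forall a, pi a <> 0 -> exists b, a * b = 1.
Local Notation m := [set x | pi x = 0].
Variables y w : R.
Hypotheses (my : pi y = 0) (mw : pi w = 0).
Hypothesis m2_yw : forall s t, pi s = 0 -> pi t = 0 -> exists c, s * t = c * (y * w).
Variable N : nat.
Hypothesis m_nil : ideal_exp m N = [set 0].

Let K := [set v | exists c, v = c * (y * w)].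

Let K_ideal : is_ideal K.
Proof.
split=> [|_ _ [c ->] [d ->]|a _ [c ->]]; first by exists 0; rewrite mul0r.
  by exists (c + d); rewrite mulrDl.
by exists (a * c); rewrite mulrA.
Qed.

(** A coefficient in m multiplied by [y] is again a multiple of [y * w], which trades it for one
    more power of [w]; nilpotence of m ends the process. *)
Let K_cases v : K v -> v = 0 \/ exists j u, pi u <> 0 /\ v = u * (y * w ^+ j).
Proof.
move=> [c ->].
have [?|[c' cE]] : (exists j u, pi u <> 0 /\ c * (y * w) = u * (y * w ^+ j)) \/
    exists c', c * (y * w) = c' * (y * w ^+ N.+1).
- elim: N => [|n [IH|[c' cE]]]; first by right; exists c; rewrite expr1.
    by left.
  have [mc'|uc'] := pselect (pi c' = 0); last by left; exists n.+1, c'.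
  have [d dE] := m2_yw mc' my; right; exists d.
  by rewrite cE mulrA dE [in RHS]exprS; ring.
- by right.
left; rewrite cE exprS.
have : ideal_exp m N (\prod_(i < N) w) by apply: prod_ideal_exp.
by rewrite prodr_const card_ord m_nil => /= ->; rewrite !mulr0.
Qed.

Lemma m2_total u v : K u -> K v -> (exists c, v = c * u) \/ (exists c, u = c * v).
Proof.
move=> /K_cases[->|[i [a [/unitR[a' aa'] ->]]]]; first by right; exists 0; rewrite mul0r.
move=> /K_cases[->|[j [b [/unitR[b' bb'] ->]]]]; first by left; exists 0; rewrite mul0r.
have [ij|/ltnW ij] := leqP i j; rewrite -(subnKC ij) exprD; [left|right].
  exists (b * a' * w ^+ (j - i)).
  have -> : b * a' * w ^+ (j - i) * (a * (y * w ^+ i)) =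
    (a * a') * (b * (y * (w ^+ i * w ^+ (j - i)))) by ring.
  by rewrite aa' mul1r.
exists (a * b' * w ^+ (i - j)).
have -> : a * b' * w ^+ (i - j) * (b * (y * w ^+ j)) =
  (b * b') * (a * (y * (w ^+ j * w ^+ (i - j)))) by ring.
by rewrite bb' mul1r.
Qed.

Lemma max_fixed_eq0 a b : pi a = 0 -> b = a * b -> b = 0.
Proof.
move=> ma bE; have [u uE] : exists u, (1 - a) * u = 1.
  by apply: unitR; rewrite rmorphB rmorph1 /= ma subr0; apply/eqP/oner_neq0.
by rewrite -[b]mul1r -uE mulrAC mulrBl mul1r -bE subrr mul0r.
Qed.

(** A nonzero triple product makes [y * w * w] nonzero, and then [w * w] is a unit multiple of
    [y * w], so [x = w] works. *)
Lemma m3_generator s t v : pi s = 0 -> pi t = 0 -> pi v = 0 -> s * t * v <> 0 ->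
  exists x, [/\ pi x = 0, x * x * x <> 0 &
    forall s t, pi s = 0 -> pi t = 0 -> exists c, s * t = c * (x * x)].
Proof.
move=> ms mt mv stv; have [c stE] := m2_yw ms mt.
have [c1 yvE] := m2_yw my mv; have [c2 wwE] := m2_yw mw mw.
have yww : y * w * w <> 0.
  move=> yww0; apply: stv; rewrite stE.
  have -> : c * (y * w) * v = c * w * (y * v) by ring.
  rewrite yvE; have -> : c * w * (c1 * (y * w)) = c * c1 * (y * w * w) by ring.
  by rewrite yww0 mulr0.
have uc2 : pi c2 <> 0.
  (* With [c2] in m, [c2 * y = c3 * (y * w)] gives [y * w * w = c3 * y * (y * w * w)], hence
     zero. *)
  move=> mc2; have [c3 c2yE] := m2_yw mc2 my; apply: yww.
  apply: (@max_fixed_eq0 (c3 * y)); first by rewrite rmorphM /= my mulr0.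
  have e : y * w * w = c2 * y * (y * w) by rewrite -mulrA wwE; ring.
  by rewrite {1}e c2yE; ring.
have [b c2b] := unitR uc2; exists w; split=> //.
  rewrite wwE => c2yww; apply: yww; rewrite -[y * w * w]mul1r -c2b.
  have -> : c2 * b * (y * w * w) = b * (c2 * (y * w) * w) by ring.
  by rewrite c2yww mulr0.
move=> s' t' ms' mt'; have [c' ->] := m2_yw ms' mt'; exists (c' * b).
by rewrite wwE; have -> : c' * b * (c2 * (y * w)) = c2 * b * (c' * (y * w)) by [ring]; rewrite c2b mul1r.
Qed.

(** * Consecutive differentials when m^2 is principal *)

Section TwoDifferentials.
Variables (b2 b1 b0 : nat) (D : 'M[R]_(b2, b1)) (D' : 'M[R]_(b1, b0)).
Hypotheses (mD : forall i j, pi (D i j) = 0) (mD' : forall i j, pi (D' i j) = 0).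
Hypothesis exD : exact_mx D D'.

(** [X *m D'] has entries in m^2, so [free_left_kernel] supplies combinations [U] killing it, and
    exactness places [U *m X] in the row space of [D]. *)
Lemma lift_to_syzygy s c (X : 'M[R]_(c, b1)) :
  (forall i j, pi (X i j) = 0) -> (s + b0 <= c)%N ->
  exists U Y, U *m X = Y *m D /\ row_free (map_mx pi (U : 'M_(s, c))).
Proof.
move=> mX sc.
have KW i j : K ((X *m D') i j).
  rewrite mxE; apply: ideal_sum => // l _; exact: m2_yw.
have [U UW fU] := free_left_kernel pi K_ideal m2_total KW sc.
have [Y YE] : exists Y, U *m X = Y *m D by apply: exD; rewrite -mulmxA.
by exists U, Y.
Qed.

(** Lifting [x] times the identity gives [x *: U = Y *m D] with [b1 - b0] rows of [U] independent
    modulo m; comparing coordinates along [x], the residue of [U] factors through that of [A]. *)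
Lemma coord_rank J x (A : 'M_(b2, b1)) : hyperplane pi J x -> pi x = 0 ->
  (forall i j, J ((D - x *: A) i j)) -> (b1 <= b0 + \rank (map_mx pi A))%N.
Proof.
move=> hyp mx AJ; have [hJ _ _] := hyp.
have [b10|b01] := leqP b1 b0; first exact: leq_trans (leq_addr _ _).
have [||U [Y [UY fU]]] := @lift_to_syzygy (b1 - b0) b1 x%:M.
- by move=> i j; rewrite mxE rmorphMn /= mx mul0rn.
- by rewrite subnK // ltnW.
have YA : map_mx pi Y *m map_mx pi A = map_mx pi U.
  apply: (hyperplane_coordM unitR hyp AJ) => i j.
  by rewrite -UY mul_mx_scalar subrr mxE; apply: ideal0.
rewrite -leq_subLR -(eqP fU) -YA; exact: mxrankM_maxr.
Qed.

(** Stack [x i] times the identity for the three [i] and lift. The coordinates of [Y *m D] along the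
    three dual hyperplanes recover the blocks of [U], so a matrix of rank [3 * b1 - b0] over [k]
    factors through [k^b2]. *)
Lemma betti_growth (x : 'I_3 -> R) J :
  (forall i, pi (x i) = 0) -> (forall i, hyperplane pi (J i) (x i)) ->
  (forall i j, i != j -> J i (x j)) -> (3 * b1 <= b2 + b0)%N.
Proof.
move=> mx hyp dual.
have hJ i : is_ideal (J i) by case: (hyp i).
have [b30|b03] := leqP (b1 + (b1 + b1)) b0; first by lia.
have /choice[A AE] := fun i => hyperplane_coord (hyp i) mD.
pose z0 : 'I_3 := ord0; pose z1 : 'I_3 := inord 1; pose z2 : 'I_3 := inord 2.
have scal0 i p q : pi ((x i)%:M p q : R) = 0 by rewrite mxE rmorphMn /= mx mul0rn.
have [||U [Y [UY fU]]] := @lift_to_syzygy (b1 + (b1 + b1) - b0) _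
   (col_mx (x z0)%:M (col_mx (x z1)%:M (x z2)%:M)).
- by move=> i j; rewrite mxE; case: splitP => a _; [|rewrite mxE; case: splitP => a0 _];
    apply: scal0.
- by rewrite subnK // ltnW.
move: UY; rewrite -[U]hsubmxK -[rsubmx U]hsubmxK.
set U0 := lsubmx U; set U1 := lsubmx _; set U2 := rsubmx _.
rewrite !mul_row_col !mul_mx_scalar => UY.
have UA i (V : 'M_(_, _)) : (forall p q, J i ((Y *m D - x i *: V) p q)) ->
   map_mx pi Y *m map_mx pi (A i) = map_mx pi V.
  exact: (hyperplane_coordM unitR (hyp i) (AE i)).
have UA0 : map_mx pi Y *m map_mx pi (A z0) = map_mx pi U0.
  apply: UA => p q; rewrite -UY addrC addKr !mxE.
  by apply: idealD => //; rewrite mulrC; apply: idealM => //; apply: dual;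
     rewrite -val_eqE /= ?inordK.
have UA1 : map_mx pi Y *m map_mx pi (A z1) = map_mx pi U1.
  apply: UA => p q; rewrite -UY [x z1 *: _ + _]addrC addrA addrK !mxE.
  by apply: idealD => //; rewrite mulrC; apply: idealM => //; apply: dual;
     rewrite -val_eqE /= ?inordK.
have UA2 : map_mx pi Y *m map_mx pi (A z2) = map_mx pi U2.
  apply: UA => p q; rewrite -UY addrA addrK !mxE.
  by apply: idealD => //; rewrite mulrC; apply: idealM => //; apply: dual;
     rewrite -val_eqE /= ?inordK.
have UE : map_mx pi U = map_mx pi Y *m
    row_mx (map_mx pi (A z0)) (row_mx (map_mx pi (A z1)) (map_mx pi (A z2))).
  by rewrite !mul_mx_row UA0 UA1 UA2 -!map_row_mx !hsubmxK.
have : (b1 + (b1 + b1) - b0 <= b2)%N.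
  rewrite -(eqP fU) UE (leq_trans (mxrankM_maxl _ _)) //; exact: rank_leq_col.
by lia.
Qed.

Variables (e : nat) (x0 : 'I_e -> R).
Hypotheses (mx0 : forall i, pi (x0 i) = 0).
Hypothesis gen0 : generates_over pi [set 0] x0.

(** Otherwise m modulo [I] has a minimal generator with a hyperplane containing [I]; along it [D]
    has coordinate matrix 0, against [coord_rank]. *)
Lemma entries_generate I : is_ideal I -> (forall i j, I (D i j)) -> (b0 < b1)%N ->
  m `<=` I.
Proof.
move=> hI ID b01; have gen : generates_over pi I x0.
  by move=> v /gen0[c vE]; exists c; rewrite vE; apply: ideal0.
have [n [x [J [mx genx hyp IJ _]]]] :=
  dual_hyperplanes unitR (G := fun v => pi v = 0) hI mx0 gen.
case: n x J mx genx hyp IJ => [|n] x J mx genx hyp IJ v mv.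
  by have [c] := genx v mv; rewrite big_ord0 subr0.
have := coord_rank (hyp ord0) (mx ord0) (A := 0).
rewrite map_mx0 mxrank0 addn0 leqNgt b01; case/(_ _)/notF => i j.
by rewrite scaler0 subr0; apply: IJ.
Qed.

Lemma minors1_max : (b0 < b1)%N -> ideal_exp m 1 `<=` minors_ideal 1 D.
Proof.
move=> b01; rewrite ideal_exp1; last exact: max_ideal.
apply: entries_generate => // [|i j]; first exact: minors_ideal_ideal.
have := minors_ideal_mem (D := D) (fun _ : 'I_1 => i) (fun=> j).
by rewrite det_mx11 mxE.
Qed.

(** Here m^2 is a simple module spanned by [y * w], so every 2-minor is zero or generates m^2, and
    one nonzero minor suffices. *)
Lemma minors2_max : y * w <> 0 -> (forall s, pi s = 0 -> y * w * s = 0) ->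
  (b0 + e < b1)%N -> ideal_exp m 2 `<=` minors_ideal 2 D.
Proof.
move=> yw0 yws b01.
have hI := minors_ideal_ideal 2 D.
have kill a c : pi a = 0 -> a * (c * (y * w)) = 0.
  by move=> ma; rewrite mulrCA [a * _]mulrC yws ?mulr0.
suff ywI : minors_ideal 2 D (y * w).
  apply: ideal_exp_sub => // u mu; rewrite !big_ord_recl big_ord0 mulr1.
  by have [c ->] := m2_yw (mu ord0) (mu (lift ord0 ord0)); apply: (idealM hI).
(* If [w] killed every entry, it would kill m, which the entries generate, and [y * w] would
   vanish. *)
have [p [i Dpi]] : exists p i, D p i * w <> 0.
  apply: contrapT => nD; apply: yw0.
  suff : m `<=` [set v | v * w = 0] by apply.
  apply: entries_generate => [|p i|].
  - split=> [|u v /= u0 v0|a u /= u0]; first by rewrite /= mul0r.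
      by rewrite mulrDl u0 v0 addr0.
    by rewrite -mulrA u0 mulr0.
  - by apply: contrapT => pi0; apply: nD; exists p, i.
  - exact: leq_ltn_trans (leq_addr _ _) b01.
set d := D p i in Dpi; have md : pi d = 0 by apply: mD.
(* [d * w] also spans m^2: its coefficient on [y * w] is a unit, as m kills [y * w]. *)
have mulE s t : pi s = 0 -> pi t = 0 -> exists c, s * t = c * (d * w).
  move=> ms mt; have [c ->] := m2_yw ms mt; have [c' dw] := m2_yw md mw.
  have /unitR[b c'b] : pi c' <> 0.
    move=> mc'; apply: Dpi; rewrite dw.
    by rewrite [c' * _]mulrC yws.
  exists (c * b); rewrite dw; have -> : c * b * (c' * (y * w)) = c' * b * (c * (y * w)) by ring.
  by rewrite c'b mul1r.
have hJ : is_ideal [set v | d * v = 0].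
  split=> [|u v /= u0 v0|a u /= u0]; first by rewrite /= mulr0.
    by rewrite mulrDr u0 v0 addr0.
  by rewrite mulrCA u0 mulr0.
have hyp : hyperplane pi [set v | d * v = 0] w.
  split=> // v mv; have [c dv] := mulE _ _ md mv.
  by exists c => /=; rewrite mulrBr dv; ring.
have [A AJ] := hyperplane_coord hyp mD.
have rA := coord_rank hyp mw AJ.
(* If all 2x2 minors vanish then [d * D q j = D p j * D q i]; expanding row p
   on the e generators of m bounds the rank of the coordinate matrix by e. *)
apply: contrapT => nI.
have minor0 q j : d * D q j = D p j * D q i.
  pose f := [fun a : 'I_2 => if a == ord0 then p else q].
  pose g := [fun a : 'I_2 => if a == ord0 then i else j].
  have := minors_ideal_mem (D := D) f g; rewrite (expand_det_row _ ord0) !big_ord_recl big_ord0.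
  rewrite /cofactor !det_mx11 !mxE /= /d => Iv.
  have : minors_ideal 2 D (D p i * D q j - D p j * D q i).
    by move: Iv; congr (minors_ideal 2 D _); rewrite !expr0 expr1; ring.
  have [c cE] : exists c, D p i * D q j - D p j * D q i = c * (y * w).
    have [c1 ->] := m2_yw (mD p i) (mD q j); have [c2 ->] := m2_yw (mD p j) (mD q i).
    by exists (c1 - c2); rewrite mulrBl.
  (* A unit [c] would put [y * w] into the ideal of minors; so [c] lies in m and the minor is
     zero. *)
  rewrite cE => Ic; have mc : pi c = 0.
    apply: contrapT => /unitR[b cb]; apply: nI.
    by rewrite -[y * w]mul1r -cb mulrAC [_ * b]mulrC; apply: (idealM hI).
  by apply/eqP; rewrite -subr_eq0 cE mulrC yws.
have /choice[a aE] : forall j, exists a : 'I_e -> R, D p j = \sum_l a l * x0 l.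
  by move=> j; have [a /eqP] := gen0 (mD p j); rewrite subr_eq0 => /eqP; exists a.
have /choice[C CE] := fun ql : 'I_b2 * 'I_e => mulE _ _ (mx0 ql.2) (mD ql.1 i).
have AE : map_mx pi A = map_mx pi (\matrix_(q, l) C (q, l)) *m map_mx pi (\matrix_(l, j) a j l).
  rewrite -map_mxM; apply/matrixP => q j; rewrite mxE [RHS]mxE.
  apply/eqP; rewrite -subr_eq0 -rmorphB; apply/eqP.
  apply: (hyperplane_scal unitR hyp); rewrite /= mulrCA mulrBr.
  have := AJ q j; rewrite /= !mxE mulrBr minor0 aE => /eqP; rewrite subr_eq0 => /eqP e1.
  rewrite mulrBr [w * (d * A q j)]mulrCA -e1 !mulr_sumr mulr_suml.
  apply/eqP; rewrite subr_eq0; apply/eqP; apply: eq_bigr => l _.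
  by have := CE (q, l); rewrite !mxE -mulrA /= => ->; ring.
move: rA; rewrite AE leqNgt => /negP; apply; apply: leq_trans b01.
by rewrite ltnS leq_add2l (leq_trans (mxrankM_maxr _ _)) // rank_leq_row.
Qed.

(** Write [D = x *: A + E] with [x *: E = 0]. A minor of [D] is [x ^+ r] times that of [A] plus that
    of [E]. The last is a multiple of [x ^+ r.+1], and the minor of [A] can be chosen a unit, so the
    ideal contains [x ^+ r], whose multiples include m^r. *)
Lemma minors_square_max x r : pi x = 0 -> x * x * x <> 0 ->
  (forall s t, pi s = 0 -> pi t = 0 -> exists c, s * t = c * (x * x)) ->
  (1 < r)%N -> (b0 + r <= b1)%N -> ideal_exp m r `<=` minors_ideal r D.
Proof.
move=> mx xxx m2_x r1 b01.
have hI := minors_ideal_ideal r D.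
have hJ : is_ideal [set v | x * v = 0].
  split=> [|u v /= u0 v0|a u /= u0]; first by rewrite /= mulr0.
    by rewrite mulrDr u0 v0 addr0.
  by rewrite mulrCA u0 mulr0.
have hyp : hyperplane pi [set v | x * v = 0] x.
  split=> // [xx0|v mv]; first by apply: xxx; rewrite /= in xx0; rewrite xx0 mul0r.
  by have [c xv] := m2_x _ _ mx mv; exists c => /=; rewrite mulrBr xv; ring.
have [A AJ] := hyperplane_coord hyp mD.
have rA : (r <= \rank (map_mx pi A))%N by have := coord_rank hyp mx AJ; lia.
have [f [g]] := rank_unit_minor rA; rewrite -map_mxsub det_map_mx => /eqP pdetA.
have prod_pow s (u : 'I_s.+2 -> R) : (forall i, pi (u i) = 0) ->
    exists c, \prod_i u i = c * x ^+ s.+2.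
  elim: s u => [|s IH] u mu; rewrite big_ord_recl.
    by rewrite big_ord_recl big_ord0 mulr1 expr2; apply: m2_x.
  have [c ->] := IH (fun i => u (lift ord0 i)) (fun i => mu _).
  have [c' ux] := m2_x _ _ (mu ord0) mx; exists (c * c').
  by rewrite mulrCA exprS [u ord0 * _]mulrA ux !exprS; ring.
(* With three or more factors the product vanishes, because two of them already give a multiple of
   [x * x]. With two, [c * (x * x * x) = 0] forces [c] into m, so [c * x] is a multiple of
   [x * x]. *)
have prod_ann (u : 'I_r -> R) : (forall i, pi (u i) = 0) ->
    (forall i, x * u i = 0) -> exists c, \prod_i u i = c * x ^+ r.+1.
  case: (r) r1 u => [//|[//|s]] _ u mu xu.
  rewrite !big_ord_recl /= mulrA; set v := u _; set v' := u _.
  have [c vv'] : exists c, v * v' = c * (x * x) by apply: m2_x; apply: mu.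
  have cx3 : c * (x * x * x) = 0.
    by rewrite mulrA -vv' mulrAC [_ * x]mulrC xu mul0r.
  case: s u mu xu @v @v' vv' => [|s] u mu xu v v' vv'; last first.
    exists 0; rewrite big_ord_recl mulrA vv'; set u3 := u _; set p3 := \prod_(_ < _) _.
    have -> : c * (x * x) * u3 * p3 = c * x * (x * u3) * p3 by ring.
    by rewrite xu mulr0 !mul0r.
  have mc : pi c = 0.
    apply: contrapT => /unitR[b cb]; apply: xxx.
    by rewrite -[_ * x]mul1r -cb mulrAC cx3 mul0r.
  have [c' cx] := m2_x _ _ mc mx; exists c'.
  by rewrite big_ord0 mulr1 vv' mulrA cx; ring.
have mE i j : pi ((D - x *: A) i j) = 0.
  by rewrite !mxE rmorphB rmorphM /= mx mul0r subr0 mD.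
have [c detE] : exists c, \det (mxsub f g (D - x *: A)) = c * x ^+ r.+1.
  have hX : is_ideal [set v | exists c, v = c * x ^+ r.+1].
    split=> [|_ _ [a ->] [b ->]|a _ [b ->]]; first by exists 0; rewrite mul0r.
      by exists (a + b); rewrite mulrDl.
    by exists (a * b); rewrite mulrA.
  apply: (ideal_sum hX) => s _; apply: (idealM hX); apply: prod_ann => i; rewrite mxE //.
  exact: AJ.
have detD : \det (mxsub f g D) = x ^+ r * (\det (mxsub f g A) + c * x).
  have -> : mxsub f g D = x *: mxsub f g A + mxsub f g (D - x *: A).
    by apply/matrixP => i j; rewrite !mxE; ring.
  case: (r) r1 f g detE pdetA => [//|s] _ f g detE pdetA.
  rewrite det_orthogonalD => [|i j]; last by rewrite mxE; apply: AJ.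
  by rewrite detE !exprS; ring.
have [b bE] : exists b, (\det (mxsub f g A) + c * x) * b = 1.
  by apply: unitR; rewrite rmorphD rmorphM /= mx mulr0 addr0.
have xrI : minors_ideal r D (x ^+ r).
  rewrite -[x ^+ r]mulr1 -bE mulrA -detD.
  by apply: (ideal_mulr _ hI); apply: minors_ideal_mem.
apply: ideal_exp_sub => // u mu.
have [a ->] : exists a, \prod_i u i = a * x ^+ r.
  by case: (r) r1 u mu => [//|[//|s]] _ u mu; apply: prod_pow.
exact: (idealM hI).
Qed.

Lemma minors_max r : (0 < r)%N -> (b0 + e + r < b1)%N ->
  ideal_exp m r `<=` minors_ideal r D.
Proof.
move=> r0 b01; have hI := minors_ideal_ideal r D.
have [r1|r1] := leqP r 1.
  have -> : r = 1%N by lia.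
  by apply: minors1_max; lia.
have zero : ideal_exp m r `<=` [set 0] -> ideal_exp m r `<=` minors_ideal r D.
  by move=> h v /h ->; apply: ideal0.
have [yw0|yw0] := pselect (y * w = 0).
  apply: zero => v /(ideal_exp_dec r1).
  apply: (ideal_exp_sub (is_ideal0 R)) => u mu.
  rewrite !big_ord_recl big_ord0 mulr1.
  by have [c ->] := m2_yw (mu ord0) (mu (lift ord0 ord0)); rewrite yw0 mulr0.
have [[s [t [v [ms [mt [mv]]]]]]|no3] :=
  pselect (exists s t v, pi s = 0 /\ pi t = 0 /\ pi v = 0 /\ s * t * v <> 0).
  by move=> /(m3_generator ms mt mv)[x [mx xxx m2_x]]; apply: (minors_square_max mx) => //; lia.
have zero3 s t v : pi s = 0 -> pi t = 0 -> pi v = 0 -> s * t * v = 0.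
  by move=> ms mt mv; apply: contrapT => nz; apply: no3; exists s, t, v.
have [r2|r2] := leqP r 2.
  have -> : r = 2%N by lia.
  apply: minors2_max => // [v mv|]; first exact: zero3.
  by lia.
apply: zero => v /(ideal_exp_dec r2).
apply: (ideal_exp_sub (is_ideal0 R)) => u mu.
by rewrite !big_ord_recl big_ord0 mulr1 mulrA; apply: zero3; apply: mu.
Qed.

End TwoDifferentials.
End Stretched.

(** * Stretched rings *)

(** [h J] counts the steps of the series at which [J] gains an element, which is the length of [J].
    If [J] and [J'] gain at the same steps, simplicity of each step lets elements of [J'] be
    corrected by elements of [J] down the series, so the ideals agree. *)
Lemma composition_height (R : comNzRingType) l : ring_length R l ->
  exists h : set R -> nat, (forall J, (h J <= l)%N) /\
    forall J J', is_ideal J -> is_ideal J' -> J `<=` J' -> ~ J' `<=` J ->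
      (h J < h J')%N.
Proof.
move=> [I [I0 Il hI Istep]].
pose meets (J : set R) i := `[< exists x, [/\ J x, I i.+1 x & ~ I i x] >].
exists (fun J => \sum_(i < l) meets J i)%N; split.
  move=> J; rewrite -[leqRHS]card_ord -sum1_card.
  by apply: leq_sum => i _; apply: leq_b1.
move=> J J' hJ hJ' JJ' nJJ'.
have mono i : (meets J i <= meets J' i)%N.
  have [/asboolP[x [/JJ' Jx Ix nIx]]|//] := boolP (meets J i).
  by rewrite (_ : meets J' i) //; apply/asboolP; exists x.
rewrite ltnNge; apply/negP => sumle; apply: nJJ'.
have eqm i : (i < l)%N -> meets J i = meets J' i.
  move=> il; have := mono i; case Ji: (meets J i); case J'i: (meets J' i) => // _.
  move: sumle; rewrite leqNgt (bigD1 (Ordinal il)) //= [ltnRHS](bigD1 (Ordinal il)) //=.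
  by rewrite Ji J'i add0n add1n ltnS leq_sum.
suff JI i : (i <= l)%N -> J' `&` I i `<=` J.
  by move=> x J'x; apply: (JI l) => //; split=> //; rewrite Il.
elim: i => [_ x [_]|i IH il y [J'y Iy]].
  by rewrite I0 => ->; apply: ideal0.
have hIi := hI _ (ltnW il); have [Ilt Imin] := Istep _ il.
have [Iiy|nIiy] := pselect (I i y); first by apply: IH => //; apply: ltnW.
have /asboolP[x [Jx Ix nIx]] : meets J i.
  by rewrite eqm //; apply/asboolP; exists y.
pose L : set R := [set z | exists u a, I i u /\ z = u + a * x].
have hL : is_ideal L.
  split=> [|_ _ [u [a [Iu ->]]] [v [b [Iv ->]]]|c _ [u [a [Iu ->]]]].
  - by exists 0, 0; rewrite mul0r addr0; split=> //; apply: ideal0.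
  - by exists (u + v), (a + b); split; [apply: idealD|ring].
  - by exists (c * u), (c * a); split; [apply: idealM|ring].
have IiL : I i `<=` L by move=> u Iu; exists u, 0; rewrite mul0r addr0.
have LI : L `<=` I i.+1.
  move=> _ [u [a [Iu ->]]]; apply: idealD; first exact: hI.
    by case: Ilt => + _; apply.
  by apply: idealM => //; apply: hI.
have Lx : L x by exists 0, 1; rewrite mul1r add0r; split=> //; apply: ideal0.
have [LE|LE] := Imin _ hL IiL LI; first by rewrite LE in Lx.
move: Iy; rewrite -LE => -[u [a [Iu yE]]]; rewrite yE.
apply: idealD => //; last exact: idealM.
apply: IH; first exact: ltnW.
split=> //; have -> : u = y - a * x by rewrite yE addrK.
by apply: idealB => //; apply: idealM => //; apply: JJ'.
Qed.

Section Embdim.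
Variables (R : comNzRingType) (k : fieldType) (pi : {rmorphism R -> k}).
Hypothesis unitR : forall a, pi a <> 0 -> exists b, a * b = 1.
Local Notation m := [set x | pi x = 0].

Lemma embdim_generators e : embdim m e ->
  exists2 x : 'I_e -> R, forall i, pi (x i) = 0 & generates_over pi [set 0] x.
Proof.
move=> [[s <- mE] _]; exists (fun i => s`_i); last first.
  move=> v mv; have : m v by [].
  by rewrite mE ideal_gen_seqE => -[c ->]; exists c; rewrite subrr.
by move=> i; have := mem_lincomb_set (fun i : 'I_(size s) => s`_i) i;
  rewrite -ideal_gen_seqE -mE.
Qed.

Lemma embdim_le e n (x : 'I_n -> R) : embdim m e ->
  (forall i, pi (x i) = 0) -> generates_over pi [set 0] x -> (e <= n)%N.
Proof.
move=> [_ emin] mx genx.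
have -> : n = size (codom x) by rewrite size_codom card_ord.
apply: emin; rewrite -lincomb_setE; apply/seteqP; split=> [v /genx[c /eqP]|].
  by rewrite subr_eq0 => /eqP; exists c.
by apply: lincomb_set_sub => //; apply: max_ideal.
Qed.

(** A length count with [l = e + i]: the step from m to R and the at least [e] steps from m^2 to m
    leave m^2 height at most [i - 1], while the strictly decreasing powers give m^3 height at least
    [i - 2]. So no ideal lies strictly between them, and a product outside m^3 generates m^2 modulo
    m^3, thus modulo every higher power. *)
Lemma stretched_square_principal : artinian_stretched m ->
  (exists y w, [/\ pi y = 0, pi w = 0 &
    forall s t, pi s = 0 -> pi t = 0 -> exists c, s * t = c * (y * w)]) /\
  exists N, ideal_exp m N = [set 0].
Proof.
move=> [_ [l [e [i [len he lE mi0 imin]]]]]; split; last by exists i.+1.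
have hm : is_ideal m by apply: max_ideal.
have [m20|m2n0] := pselect (ideal_exp m 2 `<=` [set 0]).
  exists 0, 0; split; rewrite ?rmorph0 // => s t ms mt; exists 0.
  by rewrite mul0r; apply: m20; apply: ideal_exp2M.
have [h [hl hlt]] := composition_height len.
have [x0 mx0 gen0] := embdim_generators he.
have [n [x [J [mx genx hyp _ dual]]]] :=
  dual_hyperplanes unitR (G := fun v => pi v = 0) (is_ideal0 R) mx0 gen0.
have en : (e <= n)%N := embdim_le he mx genx.
(* m^2 <= L 0 < L 1 < ... < L n = m, so h (m^2) + n <= h m. *)
pose L (j : nat) : set R :=
  [set v | exists2 c : 'I_n -> R, v = \sum_i c i * x i & forall i : 'I_n, (j <= i)%N -> pi (c i) = 0].
have hL j : is_ideal (L j).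
  split=> [|_ _ [c -> cj] [d -> dj]|a _ [c -> cj]].
  - by exists (fun=> 0); rewrite ?big1 // => i' _; rewrite ?mul0r ?rmorph0.
  - exists (fun i => c i + d i); first by rewrite -big_split; apply: eq_bigr => i' _; rewrite mulrDl.
    by move=> i' ji; rewrite rmorphD /= cj // dj // addr0.
  - exists (fun i => a * c i); first by rewrite mulr_sumr; apply: eq_bigr => i' _; rewrite mulrA.
    by move=> i' ji; rewrite rmorphM /= cj // mulr0.
have Llt j : (j < n)%N -> (h (L j) < h (L j.+1))%N.
  move=> jn; apply: hlt => // [_ [c -> cj]|].
    by exists c => // i' ji; apply: cj; apply: ltnW.
  have Lx : L j.+1 (x (Ordinal jn)).
    exists (fun i' => (i' == Ordinal jn)%:R).
      rewrite (bigD1 (Ordinal jn)) //= eqxx mul1r big1 ?addr0 // => i' /negPf ->.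
      by rewrite mul0r.
    by move=> i' ji; rewrite -val_eqE /= gtn_eqF // rmorph0.
  move=> /(_ _ Lx)[c xE cj].
  have Jx : J (Ordinal jn) (x (Ordinal jn) * (1 - c (Ordinal jn))).
    have [hJ _ _] := hyp (Ordinal jn).
    rewrite mulrBr mulr1 {1}xE (bigD1 (Ordinal jn)) //= [x _ * _]mulrC addrAC subrr add0r.
    by apply: (ideal_sum hJ) => i' i'j; apply: (idealM hJ); apply: dual; rewrite eq_sym.
  have := hyperplane_scal unitR (hyp _) Jx.
  by rewrite rmorphB rmorph1 /= cj // subr0; apply/eqP/oner_neq0.
have hle I I' : is_ideal I -> is_ideal I' -> I `<=` I' -> (h I <= h I')%N.
  move=> hI hI' II'; have [I'I|nI'I] := pselect (I' `<=` I); last exact/ltnW/hlt.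
  by have -> : I = I' by apply/seteqP.
have hE := ideal_exp_ideal m.
have hm2 : (h (ideal_exp m 2) + n < l)%N.
  have L0 : (h (ideal_exp m 2) <= h (L 0%N))%N.
    apply: hle => //; apply: ideal_exp_sub => // u mu.
    rewrite !big_ord_recl big_ord0 mulr1; have [c /eqP] := genx _ (mu ord0).
    rewrite subr_eq0 => /eqP ->; rewrite mulr_suml.
    exists (fun i' => c i' * u (lift ord0 ord0)); first by apply: eq_bigr => i' _; rewrite mulrAC.
    by move=> i' _; rewrite rmorphM /= mu mulr0.
  have Lj j : (j <= n)%N -> (h (L 0%N) + j <= h (L j))%N.
    elim: j => [|j IH] jn; first by rewrite addn0.
    by rewrite addnS (leq_ltn_trans (IH (ltnW jn))) // Llt.
  have Lnm : (h (L n) <= h m)%N.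
    by apply: hle => // v [c -> _]; apply: (ideal_sum hm) => i' _; apply: (idealM hm); apply: mx.
  have hmT : (h m < h setT)%N.
    apply: hlt => // /(_ 1 I).
    by rewrite /= rmorph1; apply/eqP/oner_neq0.
  by have := Lj n (leqnn n); have := hl setT; lia.
have powS j : ideal_exp m j `<=` ideal_exp m j.+1 ->
    ideal_exp m j.+1 `<=` ideal_exp m j.+2.
  by move=> mj; apply: ideal_expS_sub => // s t ms /mj mt; apply: ideal_expMS.
(* One equality of consecutive powers would persist, giving m^i = m^(i+1) = 0 against the minimality
   of [i]. *)
have pow_strict j : (0 < j <= i)%N -> ~ ideal_exp m j `<=` ideal_exp m j.+1.
  move=> /andP[j0 ji] mj.
  have mjt t : ideal_exp m j `<=` ideal_exp m (j + t).
    have mjS t' : ideal_exp m (j + t') `<=` ideal_exp m (j + t').+1.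
      by elim: t' => [|t' IH]; rewrite ?addn0 // addnS; apply: powS.
    elim: t => [|t IH]; first by rewrite addn0.
    by rewrite addnS => v /IH /mjS.
  have : (i <= i.-1)%N; last by lia.
  apply: imin; rewrite prednK; last by lia.
  apply/seteqP; split=> [v|_ ->]; last exact: ideal0.
  by move=> /(ideal_exp_dec ji)/(mjt (i.+1 - j)%N); rewrite subnKC ?mi0 // ltnW.
have i2 : (2 <= i)%N.
  rewrite ltnNge; apply/negP => i1; apply: m2n0.
  by rewrite -mi0; apply: ideal_exp_dec.
have hpow t : (t <= i)%N -> (t <= h (ideal_exp m (i.+1 - t)))%N.
  elim: t => [//|t IH] ti; apply: leq_ltn_trans (IH (ltnW ti)) _.
  have -> : (i.+1 - t = (i.+1 - t.+1).+1)%N by lia.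
  by apply: hlt => //; [apply: ideal_exp_decS|apply: pow_strict; lia].
have hm3 : (i <= (h (ideal_exp m 3)).+2)%N.
  have := hpow (i - 2)%N; have -> : (i.+1 - (i - 2) = 3)%N by lia.
  by lia.
have [s [t [ms mt nst]]] : exists s t, [/\ pi s = 0, pi t = 0 & ~ ideal_exp m 3 (s * t)].
  apply: contrapT => nost; apply: (pow_strict 2%N) => //.
  apply: ideal_exp_sub => // u mu; rewrite !big_ord_recl big_ord0 mulr1.
  by apply: contrapT => n3; apply: nost; exists (u ord0), (u (lift ord0 ord0)); split=> //; apply: mu.
(* [Z j] is the ideal generated by [s * t] and m^j; at [j = i.+1] it is principal. *)
pose Z j : set R := [set v | exists c u, ideal_exp m j u /\ v = c * (s * t) + u].
have hZ j : is_ideal (Z j).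
  split=> [|_ _ [c [u [mu ->]]] [d [v [mv ->]]]|a _ [c [u [mu ->]]]].
  - by exists 0, 0; rewrite mul0r addr0; split=> //; apply: ideal0.
  - by exists (c + d), (u + v); split; [apply: idealD|ring].
  - by exists (a * c), (a * u); split; [apply: idealM|ring].
have mZ j : ideal_exp m j `<=` Z j by move=> v mv; exists 0, v; rewrite mul0r add0r.
have m2Z : ideal_exp m 2 `<=` Z 3%N.
  apply: contrapT => m2Z.
  have Zm2 : Z 3%N `<=` ideal_exp m 2.
    move=> _ [c [u [/ideal_exp_decS mu ->]]]; apply: (idealD (hE _)) => //; apply: (idealM (hE _)).
    exact: ideal_exp2M.
  have lt1 : (h (Z 3%N) < h (ideal_exp m 2))%N by apply: hlt.
  have lt2 : (h (ideal_exp m 3) < h (Z 3%N))%N.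
    apply: hlt => // /(_ (s * t)) Zst; apply: nst; apply: Zst.
    by exists 1, 0; rewrite mul1r addr0; split=> //; apply: ideal0.
  by lia.
have mZS j : ideal_exp m j.+2 `<=` Z j.+3.
  elim: j => [//|j IH]; apply: ideal_expS_sub => // a b ma /IH[c [u [mu ->]]].
  by exists (a * c), (a * u); split; [apply: ideal_expMS|ring].
have m2Zj j : ideal_exp m 2 `<=` Z j.+3.
  elim: j => [//|j IH] v /IH[c [u [/mZS[c' [u' [mu' ->]]] ->]]].
  by exists (c + c'), u'; split=> //; ring.
exists s, t; split=> // s' t' ms' mt'.
have := m2Zj (i - 2)%N _ (ideal_exp2M hm ms' mt').
have -> : (i - 2).+3 = i.+1 by lia.
by move=> [c [u []]]; rewrite mi0 => -> ->; exists c; rewrite addr0.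
Qed.
End Embdim.

(** * Minimal resolutions *)

Section RowComb.
Variables (R : comNzRingType) (A : lmodType R) (n : nat) (a : 'I_n -> A).

Definition row_comb (v : 'rV[R]_n) : A := \sum_i v 0 i *: a i.

Fact row_comb_linear : linear row_comb.
Proof.
move=> c u v; rewrite /row_comb scaler_sumr -big_split; apply: eq_bigr => i _.
by rewrite !mxE scalerDl scalerA.
Qed.

HB.instance Definition _ :=
  GRing.isLinear.Build R 'rV[R]_n A _ row_comb row_comb_linear.

End RowComb.

Lemma projective_rV (R : comNzRingType) n : projective ('rV[R]_n : lmodType R).
Proof.
move=> A B g f surjg; have /choice[a ga] := fun i => surjg (f (delta_mx 0 i)).
exists (row_comb a) => v; rewrite [in RHS](row_sum_delta v) !linear_sum /=.
by apply: eq_bigr => i _; rewrite !linearZ /= ga.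
Qed.

Section Resolution.
Variables (R : comNzRingType) (k : fieldType) (pi : {rmorphism R -> k}).
Local Notation m := [set x | pi x = 0].
Variables (M : lmodType R) (F : free_resolution M).

Lemma resolution_exact n : exact_mx (dmx F n.+1) (dmx F n).
Proof.
move=> s V V0.
have /choice[z zE] : forall i, exists z : 'rV_(rk F n.+2), row i V = z *m dmx F n.+1.
  by move=> i; apply: (proj1 (@dmx_exact _ _ F n (row i V))); rewrite -row_mul V0 row0.
exists (\matrix_i z i); apply/row_matrixP => i.
by rewrite row_mul rowK zE.
Qed.

Lemma resolution_complex n : dmx F n.+1 *m dmx F n = 0.
Proof.
apply/row_matrixP => i; rewrite row_mul row0.
by apply: (proj2 (@dmx_exact _ _ F n _)); exists (delta_mx 0 i); rewrite -rowE.
Qed.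

(** If F_n = 0, exactness writes the identity of F_(n+1) as a multiple of a differential with
    entries in m, so F_(n+1) = 0 too; the resolution then stops and bounds the projective dimension
    by [n]. *)
Lemma minimal_rank_pos : is_minimal m F -> projdim_infinite M ->
  forall n, (0 < rk F n)%N.
Proof.
move=> mF pdM n; rewrite lt0n; apply/eqP => rn0; apply: (pdM n).
have rk0 j : rk F (n + j) = 0%N.
  elim: j => [|j IH]; first by rewrite addn0.
  rewrite addnS; have [Z ZE] : exists Z, 1%:M = Z *m dmx F (n + j).+1.
    apply: resolution_exact; rewrite mul1mx; apply/matrixP => a b.
    by have := leq_trans (ltn_ord b) (eq_leq IH).
  apply/eqP; rewrite -leqn0 leqNgt; apply/negP => rpos.
  have := congr1 (fun A : 'M_(rk F (n + j).+1) => pi (A (Ordinal rpos) (Ordinal rpos))) ZE.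
  rewrite !mxE eqxx rmorph1 rmorph_sum big1 => [/eqP|l _]; first by rewrite oner_eq0.
  by rewrite rmorphM /= (mF _ l (Ordinal rpos)) mulr0.
exists (fun i => 'rV[R]_(rk F i) : lmodType R), (fun i => mulmxr (dmx F i)), (aug F).
split=> //.
- by move=> i; apply: projective_rV.
- move=> i ni v; apply/rowP => j.
  have ri0 : rk F i = 0%N by rewrite -(subnKC (ltnW ni)).
  by have := leq_trans (ltn_ord j) (eq_leq ri0).
- exact: aug_surj.
- exact: aug_exact.
- exact: dmx_exact.
Qed.

End Resolution.

(** Each increment exceeds the previous one by at least [b n.+1], hence by at least 1. Positivity
    forbids an endless descent, so some increment is nonnegative, and from there on they grow
    without bound. *)
Lemma betti_increments_unbounded (b : nat -> nat) :
  (forall n, 0 < b n)%N -> (forall n, 3 * b n.+1 <= b n.+2 + b n)%N ->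
  forall B, exists N, forall n, (N <= n)%N -> (b n + B < b n.+1)%N.
Proof.
move=> b0 b3 B.
have [N bN] : exists N, (b N <= b N.+1)%N.
  apply: contrapT => nN.
  have dec n : (b n + n <= b 0%N)%N.
    elim: n => [|n IH]; first by rewrite addn0.
    have [le|lt] := leqP (b n) (b n.+1); first by case: nN; exists n.
    by lia.
  by have := dec (b 0%N); have := b0 (b 0%N); lia.
have inc j : (b (N + j) + j <= b (N + j).+1)%N.
  elim: j => [|j IH]; first by rewrite !addn0.
  by rewrite !addnS; have := b3 (N + j)%N; have := b0 (N + j).+1; lia.
exists (N + B.+1)%N => n Nn; have -> : n = (N + (n - N))%N by lia.
by have := inc (n - N)%N; lia.
Qed.

Lemma stretched_minors (R : comNzRingType) (k : fieldType) (pi : {rmorphism R -> k})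
    (m := [set x | pi x = 0]) (e r : nat) (M : lmodType R) (F : free_resolution M) :
  (forall a, pi a <> 0 -> exists b, a * b = 1) ->
  embdim m e -> (3 <= e)%N -> artinian_stretched m -> (0 < r)%N ->
  projdim_infinite M -> is_minimal m F ->
  exists N, forall n, (N <= n)%N -> ideal_exp m r `<=` minors_ideal r (dmx F n).
Proof.
move=> unitR he e3 str r0 pdM mF.
have [[y [w [my mw m2_yw]]] [N0 m_nil]] := stretched_square_principal unitR str.
have rpos := minimal_rank_pos mF pdM.
have [x0 mx0 gen0] := embdim_generators he.
have [n [x [J [mx genx hyp _ dual]]]] :=
  dual_hyperplanes unitR (G := fun v => pi v = 0) (is_ideal0 R) mx0 gen0.
have n3 : (3 <= n)%N := leq_trans e3 (embdim_le he mx genx).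
pose w3 := widen_ord n3.
have growth j : (3 * rk F j.+1 <= rk F j.+2 + rk F j)%N.
  apply: (betti_growth unitR my mw m2_yw m_nil (mF j.+1) (mF j)
    (@resolution_exact _ _ F j) (x := x \o w3) (J := J \o w3)) => [i|i|i1 i2 ne]; try exact: mx.
    exact: hyp.
  by apply: dual; apply: contra ne => /eqP/(congr1 val)/= /val_inj ->.
have [N inc] := betti_increments_unbounded rpos growth (e + r).
exists N.+1 => -[//|j] Nj.
apply: (minors_max unitR my mw m2_yw m_nil (mF j.+1) (mF j)
    (@resolution_exact _ _ F j) mx0 gen0) => //.
by rewrite -addnA inc.
Qed.

(** * Fiber products *)

(** For a fiber product of S and T, [a] and [b] are the maximal ideals of S and T, embedded as m_S x
    0 and 0 x m_T. *)
Record max_decomposition (R : comNzRingType) (k : fieldType)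
    (pi : {rmorphism R -> k}) (a b : set R) : Prop := MaxDecomposition {
  dec_ideall : is_ideal a;
  dec_idealr : is_ideal b;
  dec_subl : forall x, a x -> pi x = 0;
  dec_subr : forall x, b x -> pi x = 0;
  dec_sum : forall x, pi x = 0 -> exists u v, [/\ a u, b v & x = u + v];
  dec_cap : forall x, a x -> b x -> x = 0;
  dec_mul : forall x y, a x -> b y -> x * y = 0 }.

(** [Y] realizes the passage to [a]-components by row operations, so the row space of [D] is the sum
    of its parts in [a] and [b]. *)
Definition splits_rows (R : comNzRingType) (a b : set R) p q
    (D : 'M[R]_(p, q)) (Y : 'M_p) :=
  (forall i j, a ((Y *m D) i j)) /\ (forall i j, b ((D - Y *m D) i j)).

Section Decomposition.
Variables (R : comNzRingType) (k : fieldType) (pi : {rmorphism R -> k}).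
Hypothesis unitR : forall a, pi a <> 0 -> exists b, a * b = 1.
Local Notation m := [set x | pi x = 0].

Lemma max_decompositionC a b : max_decomposition pi a b -> max_decomposition pi b a.
Proof.
move=> [ha hb a0 b0 ab cap mul]; split=> // [x /ab[u [v [au bv ->]]]|x bx ax|x y bx ay].
- by exists v, u; rewrite addrC.
- exact: cap.
- by rewrite mulrC; apply: mul.
Qed.

Lemma splits_rowsC a b p q (D : 'M[R]_(p, q)) Y :
  splits_rows a b D Y -> splits_rows b a D (1%:M - Y).
Proof.
move=> [Ya Yb]; split=> i j; rewrite mulmxBl mul1mx //.
by rewrite subKr.
Qed.

(** * Syzygies along m = a + b *)

Section Syzygies.
Variables a b : set R.
Hypothesis dec : max_decomposition pi a b.
Let ha := dec_ideall dec.
Let hb := dec_idealr dec.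

(** Let [P] be the [a]-component of [D]. Since [D *m D0 = 0], [P *m D0] is minus the [b]-component
    times [D0], so it lies in both ideals and vanishes; exactness lifts [P] to [Y]. *)
Lemma splits_rows_exists p q s (D : 'M[R]_(p, q)) (D0 : 'M[R]_(q, s)) :
  exact_mx D D0 -> D *m D0 = 0 -> (forall i j, pi (D i j) = 0) ->
  exists Y, splits_rows a b D Y.
Proof.
move=> exD DD0 mD.
have /choice[u uE] : forall ij : 'I_p * 'I_q, exists u, a u /\ b (D ij.1 ij.2 - u).
  by move=> [i j] /=; have [u [v [au bv ->]]] := dec_sum dec (mD i j); exists u; rewrite addrC addKr.
pose P := \matrix_(i, j) u (i, j).
have Pa i j : a (P i j) by rewrite mxE; case: (uE (i, j)).
have Qb i j : b ((D - P) i j) by rewrite !mxE; case: (uE (i, j)).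
have PD0 : P *m D0 = 0.
  apply/matrixP => i j; rewrite [RHS]mxE; apply: (dec_cap dec).
    by rewrite mxE; apply: ideal_sum => // l _; apply: ideal_mulr.
  have -> : P *m D0 = - ((D - P) *m D0) by rewrite mulmxBl DD0 sub0r opprK.
  rewrite mxE; apply: idealN => //.
  by rewrite mxE; apply: ideal_sum => // l _; apply: ideal_mulr.
by have [Y YE] := exD _ _ PD0; exists Y; rewrite /splits_rows -YE.
Qed.

(** Writing [V = Z *m D'], the component [Z *m (Y' *m D')] lies in [a] and also in [b], hence is
    zero. *)
Lemma syzygy_in_summand p q s c (D' : 'M[R]_(p, q)) (D : 'M[R]_(q, s)) Y' (V : 'M_(c, q)) :
  exact_mx D' D -> splits_rows a b D' Y' -> V *m D = 0 -> (forall i j, b (V i j)) ->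
  exists X, V = X *m (1%:M - Y') *m D'.
Proof.
move=> exD [Ya Yb] VD Vb; have [Z ZE] := exD _ _ VD; exists Z.
have ZY0 : Z *m (Y' *m D') = 0.
  apply/matrixP => i j; rewrite [RHS]mxE; apply: (dec_cap dec).
    by rewrite mxE; apply: ideal_sum => // l _; apply: idealM.
  have -> : Z *m (Y' *m D') = V - Z *m (D' - Y' *m D') by rewrite mulmxBr -ZE subKr.
  rewrite mxE [X in _ + X]mxE; apply: idealB => //.
  by rewrite mxE; apply: ideal_sum => // l _; apply: idealM.
by rewrite -mulmxA mulmxBl mul1mx mulmxBr ZY0 subr0.
Qed.

Lemma scale_splitting_syzygy p q (D : 'M[R]_(p, q)) Y t :
  splits_rows a b D Y -> b t -> t *: Y *m D = 0.
Proof.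
move=> [Ya _] bt; apply/matrixP => i j.
by rewrite -scalemxAl mxE mulrC (dec_mul dec) // mxE.
Qed.

Section Growth.
Variables (p q s c : nat) (D : 'M[R]_(q, s)) (D' : 'M[R]_(p, q)) (D'' : 'M[R]_(c, p)).
Variables (Y : 'M[R]_q) (Y' : 'M[R]_p) (Y'' : 'M[R]_c).
Hypotheses (exD' : exact_mx D' D) (exD'' : exact_mx D'' D').
Hypotheses (mD' : forall i j, pi (D' i j) = 0) (mD'' : forall i j, pi (D'' i j) = 0).
Hypotheses (spY : splits_rows a b D Y) (spY' : splits_rows a b D' Y')
  (spY'' : splits_rows a b D'' Y'').

Lemma scaled_splitting_lift t : b t -> exists X, t *: Y = X *m (1%:M - Y') *m D'.
Proof.
move=> bt; apply: (syzygy_in_summand exD' spY') => [|i j].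
  exact: scale_splitting_syzygy spY bt.
by rewrite mxE; apply: ideal_mulr.
Qed.

(** [t *: Y] is a syzygy because [t] kills [a]; it factors through [1%:M - Y'], and its coordinate
    along [t] is the residue of [Y]. *)
Lemma rank_next1 J t : b t -> hyperplane pi J t ->
  (\rank (map_mx pi Y) <= \rank (map_mx pi (1%:M - Y')))%N.
Proof.
move=> bt hyp; have [hJ _ _] := hyp; have [A AJ] := hyperplane_coord hyp mD'.
have [X XE] := scaled_splitting_lift bt.
rewrite -(hyperplane_coordM unitR (Y := X *m (1%:M - Y')) (U := Y) hyp AJ) => [|i j].
  by rewrite map_mxM -mulmxA (leq_trans (mxrankM_maxr _ _)) // mxrankM_maxl.
by rewrite -XE subrr mxE; apply: ideal0.
Qed.

Lemma rank_next2 J1 J2 t1 t2 : b t1 -> b t2 ->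
  hyperplane pi J1 t1 -> hyperplane pi J2 t2 -> J1 t2 -> J2 t1 ->
  (2 * \rank (map_mx pi Y) <= \rank (map_mx pi (1%:M - Y')))%N.
Proof.
move=> bt1 bt2 hyp1 hyp2 J1t2 J2t1.
have [hJ1 _ _] := hyp1; have [hJ2 _ _] := hyp2.
have [A1 AJ1] := hyperplane_coord hyp1 mD'; have [A2 AJ2] := hyperplane_coord hyp2 mD'.
have [X1 XE1] := scaled_splitting_lift bt1; have [X2 XE2] := scaled_splitting_lift bt2.
have e11 := hyperplane_coordM unitR (Y := X1 *m (1%:M - Y')) (U := Y) hyp1 AJ1.
have e12 := hyperplane_coordM unitR (Y := X1 *m (1%:M - Y')) (U := 0) hyp2 AJ2.
have e21 := hyperplane_coordM unitR (Y := X2 *m (1%:M - Y')) (U := 0) hyp1 AJ1.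
have e22 := hyperplane_coordM unitR (Y := X2 *m (1%:M - Y')) (U := Y) hyp2 AJ2.
have blockE : map_mx pi (col_mx X1 X2 *m (1%:M - Y')) *m row_mx (map_mx pi A1) (map_mx pi A2) =
    block_mx (map_mx pi Y) 0 0 (map_mx pi Y).
  rewrite mul_col_mx map_col_mx mul_col_row e11 ?e12 ?e21 ?e22 ?map_mx0 // => i j;
    rewrite -?XE1 -?XE2 ?scaler0 ?subr0 ?subrr.
  - by rewrite mxE; apply: ideal0.
  - by rewrite mxE; apply: ideal_mulr.
  - by rewrite mxE; apply: ideal_mulr.
  - by rewrite mxE; apply: ideal0.
have -> : (2 * \rank (map_mx pi Y) = \rank (block_mx (map_mx pi Y) 0 0 (map_mx pi Y)))%N.
  by rewrite rank_diag_block_mx mul2n addnn.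
by rewrite -blockE map_mxM -mulmxA (leq_trans (mxrankM_maxr _ _)) // mxrankM_maxl.
Qed.

(* The Koszul relation between t1 and t2 gives syzygies one step further. *)
Lemma rank_next_koszul J1 J2 t1 t2 : b t1 -> b t2 ->
  hyperplane pi J1 t1 -> hyperplane pi J2 t2 -> J2 t1 ->
  (\rank (map_mx pi Y) <= \rank (map_mx pi (1%:M - Y'')))%N.
Proof.
move=> bt1 bt2 hyp1 hyp2 J2t1.
have [hJ1 _ _] := hyp1; have [hJ2 _ _] := hyp2.
have [A1 AJ1] := hyperplane_coord hyp1 mD'; have [A2 AJ2] := hyperplane_coord hyp2 mD''.
have [Z1 ZE1] := exD' (scale_splitting_syzygy spY bt1).
have [Z2 ZE2] := exD' (scale_splitting_syzygy spY bt2).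
(* Both [t2 *: Z1] and [t1 *: Z2] map to [t1 * t2] times [Y]. Modulo m, their difference has
   coordinate [Z1] along [t2], and [Z1 *m D'] has coordinate [Y] along [t1]. *)
have [||X XE] := syzygy_in_summand (V := t2 *: Z1 - t1 *: Z2) exD'' spY''.
- by rewrite mulmxBl -!scalemxAl -ZE1 -ZE2 !scalerA [t2 * _]mulrC subrr.
- by move=> i j; rewrite !mxE; apply: idealB => //; apply: ideal_mulr.
have e1 : map_mx pi Z1 *m map_mx pi A1 = map_mx pi Y.
  by apply: (hyperplane_coordM unitR hyp1 AJ1) => i j; rewrite -ZE1 subrr mxE; apply: ideal0.
have e2 : map_mx pi (X *m (1%:M - Y'')) *m map_mx pi A2 = map_mx pi Z1.
  apply: (hyperplane_coordM unitR hyp2 AJ2) => i j.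
  rewrite -XE addrC addKr !mxE; apply: idealN => //; exact: ideal_mulr.
rewrite -e1 -e2 (leq_trans (mxrankM_maxl _ _)) // (leq_trans (mxrankM_maxl _ _)) //.
by rewrite map_mxM mxrankM_maxr.
Qed.

(** Scale the rows of a unit minor of [Y] by the [t i]: each row of [t i *: Y] lies in the row space
    of [D'], so the scaled determinant is a combination of minors of [D']. *)
Lemma minors_prod_summand r (t : 'I_r -> R) :
  (r <= \rank (map_mx pi Y))%N -> (forall i, b (t i)) ->
  minors_ideal r D' (\prod_i t i).
Proof.
move=> rY bt; have hI := minors_ideal_ideal r D'.
have [f [g]] := rank_unit_minor rY; rewrite -map_mxsub det_map_mx => /eqP/unitR[u uE].
have /choice[Z ZE] : forall i, exists Z, t i *: Y = Z *m D'.
  by move=> i; apply: exD'; apply: scale_splitting_syzygy spY (bt i).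
have -> : \prod_i t i = \det (diag_mx (\row_i t i) *m mxsub f g Y) * u.
  rewrite det_mulmx det_diag -mulrA uE mulr1.
  by apply: eq_bigr => i _; rewrite mxE.
apply: (ideal_mulr _ hI).
have -> : diag_mx (\row_i t i) *m mxsub f g Y = (\matrix_(i, j) Z i (f i) j) *m colsub g D'.
  apply/matrixP => i j; rewrite mul_diag_mx !mxE.
  have /matrixP/(_ (f i) (g j)) := ZE i; rewrite !mxE => ->.
  by apply: eq_bigr => l _; rewrite !mxE.
exact: minors_ideal_lincomb.
Qed.

End Growth.
End Syzygies.
End Decomposition.

Lemma kernel_maximal (R : comNzRingType) (k : fieldType) (chi : R -> k) :
  (forall x y, chi (x - y) = chi x - chi y) ->
  (forall x y, chi (x * y) = chi x * chi y) -> chi 1 = 1 -> surjective chi ->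
  is_maximal_ideal [set x | chi x = 0].
Proof.
move=> chiB chiM chi1 chi_surj; have chi0 : chi 0 = 0 by rewrite -[0]subr0 chiB subrr.
have hI : is_ideal [set x | chi x = 0].
  split=> [//|x y /= x0 y0|c x /= x0]; last by rewrite chiM x0 mulr0.
  by rewrite -[y]opprK chiB x0 -[- y]sub0r chiB chi0 y0 !subr0.
split=> // [kT|J hJ kJ].
  have : [set x | chi x = 0] 1 by rewrite kT.
  by rewrite /= chi1; apply/eqP/oner_neq0.
have [Jk|nJk] := pselect (J `<=` [set x | chi x = 0]).
  by left; apply/seteqP.
right; have [x [Jx chix]] : exists x, J x /\ chi x <> 0.
  by apply: contrapT => nx; apply: nJk => x Jx; apply: contrapT => ?; apply: nx; exists x.
have [y yE] := chi_surj (chi x)^-1.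
have J1 : J 1.
  have -> : 1 = (1 - y * x) + y * x by rewrite subrK.
  apply: idealD => //; last exact: idealM.
  by apply: kJ; rewrite /= chiB chi1 chiM yE mulVf ?subrr //; apply/eqP.
by apply/seteqP; split=> // v _; rewrite -[v]mulr1; apply: idealM.
Qed.

Lemma nontrivial_maximal (S : comNzRingType) (k : fieldType) (mS : set S)
    (p : {rmorphism S -> k}) :
  noetherian_local mS p -> ~ ring_isomorphic S k -> exists2 s, s <> 0 & p s = 0.
Proof.
move=> hS nS; apply: contrapT => ns; apply: nS; exists p.
have [g gE] := choice (residue_surj hS); exists g => // s.
apply/eqP; rewrite -subr_eq0; apply/eqP; apply: contrapT => nz; apply: ns.
by exists (g (p s) - s) => //; rewrite rmorphB gE subrr.
Qed.

Lemma fiber_product_decomposition (R : comNzRingType) (m : set R) (k : fieldType)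
    (pi : {rmorphism R -> k}) :
  noetherian_local m pi -> is_fiber_product_ring R k ->
  exists a b, [/\ max_decomposition pi a b,
    exists2 x, x <> 0 & a x & exists2 x, x <> 0 & b x].
Proof.
move=> hR [S [T [mS [mT [p [q [hS hT nS nT [f [g fK gK]]]]]]]]].
have injf := can_inj fK.
pose s x : S := (fiber_val (f x)).1; pose t x : T := (fiber_val (f x)).2.
have pqE x : p (s x) = q (t x) by apply/eqP; exact: (fiber_valP (f x)).
have sB x y : s (x - y) = s x - s y by rewrite /s rmorphB.
have sM x y : s (x * y) = s x * s y by rewrite /s rmorphM.
have tB x y : t (x - y) = t x - t y by rewrite /t rmorphB.
have tM x y : t (x * y) = t x * t y by rewrite /t rmorphM.
have s0 : s 0 = 0 by rewrite -[0]subr0 sB subrr.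
have t0 : t 0 = 0 by rewrite -[0]subr0 tB subrr.
have sN x : s (- x) = - s x by rewrite -sub0r sB s0 sub0r.
have tN x : t (- x) = - t x by rewrite -sub0r tB t0 sub0r.
have sD x y : s (x + y) = s x + s y by rewrite -[y in LHS]opprK sB sN opprK.
have tD x y : t (x + y) = t x + t y by rewrite -[y in LHS]opprK tB tN opprK.
have steq x y : s x = s y -> t x = t y -> x = y.
  rewrite /s /t => sxy txy; apply: injf; apply: val_inj => /=.
  by move: sxy txy; case: (fiber_val (f x)) (fiber_val (f y)) => u v [u' v'] /= -> ->.
have mk u v : p u = q v -> exists x, s x = u /\ t x = v.
  move=> /eqP uv; exists (g (@FiberProduct S T k p q (u, v) uv)).
  by rewrite /s /t gK.
(* [pi] is compared with [p] only through kernels: both are the unique maximal ideal of [R]. *)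
have pi_s x : pi x = 0 <-> p (s x) = 0.
  have mE : [set x | p (s x) = 0] = m.
    apply: (local_unique hR); apply: kernel_maximal => [x' y|x' y||c].
    - by rewrite sB rmorphB.
    - by rewrite sM rmorphM.
    - by rewrite /s rmorph1 /= rmorph1.
    - have [u uE] := residue_surj hS c; have [v vE] := residue_surj hT c.
      by have [|z [sz _]] := mk u v; [rewrite uE vE|exists z; rewrite sz].
  by rewrite (residue_ker hR) -mE.
exists [set x | t x = 0], [set x | s x = 0]; split.
- split.
  + by split=> [//|x y /= x0 y0|c x /= x0]; rewrite ?tD ?tM ?x0 ?y0 ?addr0 ?mulr0.
  + by split=> [//|x y /= x0 y0|c x /= x0]; rewrite ?sD ?sM ?x0 ?y0 ?addr0 ?mulr0.
  + by move=> x /= tx; apply/pi_s; rewrite pqE tx rmorph0.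
  + by move=> x /= sx; apply/pi_s; rewrite sx rmorph0.
  + move=> x /pi_s psx.
    have [|u [su tu]] := mk (s x) 0; first by rewrite rmorph0.
    have [|v [sv tv]] := mk 0 (t x); first by rewrite -pqE psx rmorph0.
    exists u, v; split=> //; apply: steq; first by rewrite sD su sv addr0.
    by rewrite tD tu tv add0r.
  + by move=> x /= tx sx; apply: steq; rewrite ?s0 ?t0.
  + by move=> x y /= tx sy; apply: steq; rewrite ?sM ?tM ?sy ?tx ?s0 ?t0 ?mulr0 ?mul0r.
- have [u u0 pu] := nontrivial_maximal hS nS.
  have [|x [sx tx]] := mk u 0; first by rewrite pu rmorph0.
  by exists x => // x0; apply: u0; rewrite -sx x0 s0.
- have [u u0 pu] := nontrivial_maximal hT nT.
  have [|x [sx tx]] := mk 0 u; first by rewrite pu rmorph0.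
  by exists x => // x0; apply: u0; rewrite -tx x0 t0.
Qed.

(** Certifies one generator of m from [a] and two independent ones from [b], the asymmetry that
    makes the ranks grow. *)
Definition two_one_generators (R : comNzRingType) (k : fieldType)
    (pi : {rmorphism R -> k}) (a b : set R) :=
  exists s t1 t2 (J J1 J2 : set R),
    [/\ a s, b t1 & b t2] /\
    [/\ hyperplane pi J s, hyperplane pi J1 t1, hyperplane pi J2 t2, J1 t2 & J2 t1].

Section Decomposition.
Variables (R : comNzRingType) (k : fieldType) (pi : {rmorphism R -> k}).
Hypothesis unitR : forall a, pi a <> 0 -> exists b, a * b = 1.
Local Notation m := [set x | pi x = 0].

(** Split each generator into its parts in [a] and [b], and extract a minimal family from these
    [e + e] elements. It has at least three members, and both ideals occur because both are nonzero;
    so one of them contains two. *)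
Lemma decomposition_generators a b e : max_decomposition pi a b ->
  (exists2 x, x <> 0 & a x) -> (exists2 x, x <> 0 & b x) ->
  embdim m e -> (3 <= e)%N ->
  two_one_generators pi a b \/ two_one_generators pi b a.
Proof.
move=> dec [u u0 au] [v v0 bv] he e3.
have [x0 mx0 gen0] := embdim_generators he.
have /choice[al /choice[be abE]] := fun i => dec_sum dec (mx0 i).
pose x1 (i : 'I_(e + e)) := match split i with inl j => al j | inr j => be j end.
have Gx1 i : a (x1 i) \/ b (x1 i).
  by rewrite /x1; case: split => j; case: (abE j); [left|right].
have gen1 : generates_over pi [set 0] x1.
  move=> z /gen0[c /eqP]; rewrite subr_eq0 => /eqP ->.
  exists (fun i => match split i with inl j => c j | inr j => c j end).
  rewrite big_split_ord /= -big_split /=; apply/eqP; rewrite subr_eq0; apply/eqP.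
  apply: eq_bigr => i _; rewrite /x1 -![lshift _ _]/(unsplit (inl _)) -![rshift _ _]/(unsplit (inr _)).
  by rewrite !unsplitK -mulrDr; case: (abE i) => _ _ ->.
have [n [x [J [Gx genx hyp _ dual]]]] :=
  dual_hyperplanes unitR (G := fun z => a z \/ b z) (is_ideal0 R) Gx1 gen1.
have n3 : (3 <= n)%N.
  apply: leq_trans e3 (embdim_le he _ genx) => i.
  by case: (Gx i) => [/(dec_subl dec)|/(dec_subr dec)].
have one c d z : is_ideal c -> z <> 0 -> d z -> pi z = 0 -> (forall y, d y -> c y -> y = 0) ->
    (forall i, d (x i) \/ c (x i)) -> exists i, d (x i).
  move=> hc z0 dz mz cap dc; apply: contrapT => nd; apply: z0; apply: cap => //.
  have [co /eqP] := genx _ mz; rewrite subr_eq0 => /eqP ->.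
  apply: ideal_sum => // i _; apply: idealM => //.
  by case: (dc i) => // di; case: nd; exists i.
have [ia aia] : exists i, a (x i).
  apply: (one b a u) => //; [exact: dec_idealr dec|exact: dec_subl dec _ au|exact: dec_cap dec].
have [ib bib] : exists i, b (x i).
  apply: (one a b v) => //; [exact: dec_ideall dec|exact: dec_subr dec _ bv| |].
    by move=> y by_ ay; apply: (dec_cap dec).
  by move=> i; case: (Gx i); [right|left].
have two c d i j l : c (x l) -> d (x i) -> d (x j) -> i != j -> two_one_generators pi c d.
  move=> cl di dj ij; exists (x l), (x i), (x j), (J l), (J i), (J j).
  by split; split=> //; apply: dual; rewrite // eq_sym.
pose i0 := Ordinal (leq_trans (isT : 0 < 3)%N n3).
pose i1 := Ordinal (leq_trans (isT : 1 < 3)%N n3).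
pose i2 := Ordinal (leq_trans (isT : 2 < 3)%N n3).
have [n01 n02 n12] : [/\ i0 != i1, i0 != i2 & i1 != i2] by [].
case: (Gx i0) (Gx i1) (Gx i2) => g0 [] g1 [] g2;
  first [ by left; apply: (two _ _ _ _ ia aia g0 g1) | by left; apply: (two _ _ _ _ ia aia g0 g2)
        | by left; apply: (two _ _ _ _ ia aia g1 g2) | by right; apply: (two _ _ _ _ ib bib g0 g1)
        | by right; apply: (two _ _ _ _ ib bib g0 g2) | by right; apply: (two _ _ _ _ ib bib g1 g2) ].
Qed.

End Decomposition.

(** [al] doubles every two steps through [be], which preserves the parity of the index; the bound
    [al n <= al n.+3] carries the growth over to the other parity. *)
Lemma coupled_growth (al be : nat -> nat) :
  (forall n, 2 * al n <= be n.+1)%N -> (forall n, be n <= al n.+1)%N ->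
  (forall n, al n <= be n.+2)%N -> (0 < al 0%N + be 0%N)%N ->
  forall B, exists N, forall n, (N <= n)%N -> (B <= al n)%N /\ (B <= be n)%N.
Proof.
move=> h2 h1 hk pos B.
have al2 n : (2 * al n <= al n.+2)%N := leq_trans (h2 n) (h1 n.+1).
have al3 n : (al n <= al n.+3)%N := leq_trans (hk n) (h1 n.+2).
have [N0 aN0] : exists n, (0 < al n)%N.
  have [a0|a0] := posnP (al 0%N); last by exists 0%N.
  by exists 1%N; apply: leq_trans (h1 0%N); rewrite a0 in pos.
have [N [aN aN1]] : exists N, (B < al N)%N /\ (B < al N.+1)%N.
  elim: B => [|A [N [aN aN1]]].
    by exists N0.+2; split; [have := al2 N0; lia|exact: leq_trans (al3 N0)].
  by exists N.+2; have := al2 N; have := al2 N.+1; split; lia.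
have alN j : (B < al (N + j))%N /\ (B < al (N + j).+1)%N.
  elim: j => [|j [IH IH1]]; first by rewrite addn0.
  by rewrite addnS; split=> //; have := al2 (N + j)%N; lia.
exists N.+1 => -[//|n] Nn; have [] := alN (n - N)%N; rewrite subnKC // => an an1.
by split; [lia|have := h2 n; lia].
Qed.

Lemma max_power_split (R : comNzRingType) (k : fieldType) (pi : {rmorphism R -> k})
    (a b I : set R) r :
  max_decomposition pi a b -> is_ideal I -> (0 < r)%N ->
  (forall u : 'I_r -> R, (forall i, a (u i)) -> I (\prod_i u i)) ->
  (forall u : 'I_r -> R, (forall i, b (u i)) -> I (\prod_i u i)) ->
  ideal_exp [set x | pi x = 0] r `<=` I.
Proof.
case: r => // r dec hI _ Ia Ib; apply: ideal_exp_sub => // u mu.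
have /choice[al /choice[be abE]] := fun i => dec_sum dec (mu i).
have -> : \prod_i u i = \prod_i (al i + be i) by apply: eq_bigr => i _; case: (abE i).
rewrite prod_orthogonalD => [|i j]; last first.
  by apply: (dec_mul dec); [case: (abE i)|case: (abE j)].
by apply: (idealD hI); [apply: Ia => i|apply: Ib => i]; case: (abE i).
Qed.

Section FiberProductMinors.
Variables (R : comNzRingType) (k : fieldType) (pi : {rmorphism R -> k}).
Hypothesis unitR : forall a, pi a <> 0 -> exists b, a * b = 1.
Local Notation m := [set x | pi x = 0].

Lemma decomposed_minors a b (M : lmodType R) (F : free_resolution M) r :
  max_decomposition pi a b -> two_one_generators pi a b ->
  projdim_infinite M -> is_minimal m F -> (0 < r)%N ->
  exists N, forall n, (N <= n)%N -> ideal_exp m r `<=` minors_ideal r (dmx F n).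
Proof.
move=> dec [s [t1 [t2 [J [J1 [J2 [[as_ bt1 bt2] [hyp hyp1 hyp2 J12 J21]]]]]]]] pdM mF r0.
have decC := max_decompositionC dec.
have ex n := @resolution_exact _ _ F n.
have spE n : exists Y, splits_rows a b (dmx F n.+1) Y.
  by apply: (splits_rows_exists dec (ex n)); [apply: resolution_complex|apply: mF].
pose Y n := projT1 (cid (spE n)).
have sp n : splits_rows a b (dmx F n.+1) (Y n) := projT2 (cid (spE n)).
have spC n : splits_rows b a (dmx F n.+1) (1%:M - Y n) by apply: splits_rowsC.
pose al n := \rank (map_mx pi (Y n)); pose be n := \rank (map_mx pi (1%:M - Y n)).
have [N alN] : exists N, forall n, (N <= n)%N -> (r <= al n)%N /\ (r <= be n)%N.
  apply: coupled_growth => [n|n|n|].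
  - exact: (rank_next2 unitR dec (ex n.+1) (mF n.+2) (sp n) (sp n.+1) bt1 bt2 hyp1 hyp2).
  - have := rank_next1 unitR decC (ex n.+1) (mF n.+2) (spC n) (spC n.+1) as_ hyp.
    by rewrite subKr.
  - exact: (rank_next_koszul unitR dec (ex n.+1) (ex n.+2) (mF n.+2) (mF n.+3)
      (sp n) (sp n.+2) bt1 bt2 hyp1 hyp2).
  (* [Y 0] and [1%:M - Y 0] sum to the identity of the nonzero F_2, so their residues are not both
     zero. *)
  - have rpos := minimal_rank_pos mF pdM 2.
    apply: leq_trans rpos _; rewrite -[leqLHS](mxrank1 k) -(map_mx1 pi).
    have {1}-> : 1%:M = Y 0%N + (1%:M - Y 0%N) by rewrite addrC subrK.
    by rewrite map_mxD mxrank_add.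
(* [Y n] splits [dmx F n.+1], and its rank controls the minors of the next differential
   [dmx F n.+2]; hence the shift by two. *)
exists N.+2 => -[//|[//|n]] Nn; have [ral rbe] := alN n Nn.
apply: (max_power_split dec) => // [|u au|u bu]; first exact: minors_ideal_ideal.
  exact: (minors_prod_summand unitR decC (ex n.+1) (spC n) rbe au).
exact: (minors_prod_summand unitR dec (ex n.+1) (sp n) ral bu).
Qed.

Lemma fiber_product_minors e (M : lmodType R) (F : free_resolution M) r :
  noetherian_local m pi -> is_fiber_product_ring R k -> embdim m e -> (3 <= e)%N ->
  projdim_infinite M -> is_minimal m F -> (0 < r)%N ->
  exists N, forall n, (N <= n)%N -> ideal_exp m r `<=` minors_ideal r (dmx F n).
Proof.
move=> hR hfib he e3 pdM mF r0.
have [a [b [dec a0 b0]]] := fiber_product_decomposition hR hfib.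
case: (decomposition_generators unitR dec a0 b0 he e3) => gens.
  exact: decomposed_minors dec gens pdM mF r0.
exact: decomposed_minors (max_decompositionC dec) gens pdM mF r0.
Qed.

End FiberProductMinors.

Theorem theoremA (R : comNzRingType) (m : set R) (k : fieldType)
    (pi : {rmorphism R -> k}) (e : nat)
    (hR : noetherian_local m pi)
    (he : embdim m e) (he3 : (3 <= e)%N)
    (hcase : is_fiber_product_ring R k \/
             [/\ artinian_stretched m, gorenstein R & 2%N \notin [pchar k]])
    (r : nat) (hr : (0 < r)%N)
    (M : lmodType R) (hfg : finitely_generated M)
    (hpd : projdim_infinite M)
    (F : free_resolution M) (hF : is_minimal m F) :
  exists N : nat, forall n : nat, (N <= n)%N ->
    resolution_minors F n r = ideal_exp m r.
Proof.
have unitR a : pi a <> 0 -> exists b, a * b = 1 by exact: (local_unit hR).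
have mE : m = [set x | pi x = 0].
  by apply/seteqP; split=> x /= /(residue_ker hR).
subst m.
have [N FN] : exists N, forall n, (N <= n)%N ->
    ideal_exp [set x | pi x = 0] r `<=` minors_ideal r (dmx F n).
  case: hcase => [hfib|[str _ _]].
    exact: fiber_product_minors hR hfib he he3 hpd hF hr.
  exact: stretched_minors unitR he he3 str hr hpd hF.
(* [resolution_minors] at [n.+1] concerns [dmx F n], hence the shift. Minimality puts the minors
   into m^r. *)
exists N.+1 => -[//|n] Nn /=; apply/seteqP; split; last exact: FN.
by apply: minors_ideal_sub; apply: hF.
Qed.
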